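(* Let $(X,T)$ be a topologically transitive group extension with property (C) of a Gibbs-Markov map with the b.i.p. property, and let $\mathcal C$, $\mathcal H$, $\mathcal H^+$, $\Theta$, $LD$, $C_\varphi$ be as in the context. The map $\Theta:\mathcal C\to\mathcal H$ is well defined (i.e. $\Theta(f)\in\mathcal H$ for every $f\in\mathcal C$). If $f\in\mathcal H$ and $f\ge0$, then $LD(f)\le C_\varphi$ and, in particular, $f\in\mathcal H^+$.
   Context: Base. $\mathcal W$ is a countable alphabet, $(a_{ij})_{i,j\in\mathcal W}$ a $0$-$1$-matrix without zero rows or columns, $\Sigma=\{(w_k)_{k\ge1}: w_k\in\mathcal W,\ a_{w_kw_{k+1}}=1\ \forall k\}$, and $\theta:\Sigma\to\Sigma$ is the left shift. $\mathcal W^n$ is the set of admissible words of length $n$, $[w]\subset\Sigma$ is the cylinder of $w$, and for $w\in\mathcal W^n$, $\tau_w:\theta^n([w])\to[w]$ is the inverse of $\theta^n|_{[w]}$. $(\Sigma,\theta)$ is topologically mixing: for all $a,b\in\mathcal W$ there is $N$ with $\theta^n([a])\cap[b]\neq\emptyset$ for all $n\ge N$. The b.i.p. property means: topologically mixing, and there is a finite set $\mathcal I\subset\mathcal W$ such that for each $v\in\mathcal W$ there are $\beta_1,\beta_2\in\mathcal I$ with $v\beta_1,\beta_2v\in\mathcal W^2$. For $f:\Sigma\to\mathbb R$, $V_n(f)=\sup\{|f(x)-f(y)|: x,y \text{ agree in the first } n \text{ letters}\}$; $f$ is locally Hölder continuous if for some $r\in(0,1)$ and $C>0$, $V_n(f)\le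 Cr^n$ for all $n\ge1$. Potential. $\varphi:\Sigma\to(0,\infty)$, $\Phi_n=\prod_{k=0}^{n-1}\varphi\circ\theta^k$, $L_\varphi f(x)=\sum_{v\in\mathcal W,\,x\in\theta([v])}\varphi(\tau_v x)f(\tau_v x)$, $\int f\,dL_\varphi^*\mu=\int L_\varphi f\,d\mu$. The Gurevič pressure is $P_G(\theta,\varphi)=\limsup_n\frac1n\log\sum_{\theta^nx=x,\,x\in[a]}\Phi_n(x)$ ($a\in\mathcal W$). Standing assumption: $P_G(\theta,\varphi)=0$. Gibbs-Markov setting. $(\Sigma,\theta)$ has the b.i.p. property, $\log\varphi$ is locally Hölder continuous ($r\in(0,1)$ is fixed with $V_n(\log\varphi)\le Cr^n$), and there is a Borel probability measure $m_0$ on $\Sigma$ with $L_\varphi^*m_0=m_0$ such that $(\Sigma,\theta,m_0)$ is Gibbs-Markov: for every $w\in\mathcal W$, $m_0|_{\theta([w])}$ and $m_0\circ\tau_w$ are equivalent, $\inf_{w\in\mathcal W}m_0(\theta([w]))>0$, and there are $r\in(0,1)$, $C>0$ with $\sup_{x,y\in[w]}|\log\frac{dm_0\circ\tau_v}{dm_0}(x)-\log\frac{dm_0\circ\tau_v}{dm_0}(y)|\le Cr^n$ for all $m,n\in\mathbb N$, $v\in\mathcal W^m$, $w\in\mathcal W^n$ with $vw\in\mathcal W^{m+n}$. Group extension. $G$ is a countable discrete group with identity $\mathrm{id}$, $\psi:\Sigma\to G$ is constant on each $[a]$, $a\in\mathcal W$; $X=\Sigma\times G$ with the product topology, $T(x,g)=(\theta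 x,g\psi(x))$, $X_g=\Sigma\times\{g\}$, $[w,g]=[w]\times\{g\}$, $\psi_n(x)=\psi(x)\cdots\psi(\theta^{n-1}x)$; for $v\in\mathcal W^n$, $\psi_v$ is the value of $\psi_n$ on $[v]$ and $\tau_v(x,g)=(\tau_v x,g\psi_v^{-1})$. $(X,T)$ is topologically transitive: for all $a,b\in\mathcal W$, $g,h\in G$ there is $n\in\mathbb N$ with $T^n([a,g])\cap[b,h]\ne\emptyset$. $\varphi,\Phi_n$ are lifted to $X$ by $\varphi(x,g)=\varphi(x)$. $\mathcal L_\varphi f(x,g)=\sum_{v\in\mathcal W,\,x\in\theta([v])}\varphi(\tau_vx)f(\tau_vx,g\psi(v)^{-1})$. The metric $d_r$ on $X$ is the shift metric: $d_r((x,g),(y,h))=r^{\min\{i:x_i\ne y_i\}-1}$ if $g=h$ and $=1$ if $g\ne h$; so $d_r<1$ iff both points lie in a common $[a,g]$, $a\in\mathcal W$. Property (C). Fix $\xi\in\Sigma$. Let $\mathcal Z^n(\xi)=\mathcal L_\varphi^n(\mathbf 1_{X_{\mathrm{id}}})(\xi,\mathrm{id})=\sum_{\theta^nx=\xi,\,\psi_n(x)=\mathrm{id}}\Phi_n(x)$ and $\rho=\limsup_n\sqrt[n]{\mathcal Z^n(\xi)}$. Consider sequences $(b_n)$, $b_n=\prod_{k=1}^n\lambda(k)$ with $\lambda(k)\ge1$ non-increasing and $\lambda(k)\to1$, such that $\sum_n b_n\mathcal Z^n(\xi)s^{-n}$ is infinite for $0<s\le\rho$ and finite for $s>\rho$.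 Put $\mathcal P(s)=\sum_n s^{-n}b_n\mathcal Z^n(\xi)$ and, for $s>\rho$, $m_s=\frac1{\mathcal P(s)}\sum_{n\in\mathbb N}s^{-n}b_n\sum_{T^n(z)=(\xi,\mathrm{id})}\Phi_n(z)\delta_z$. Property (C): for some such $(b_n)$ there is $s_k\searrow\rho$ such that the restrictions of $m_{s_k}$ to $X_{\mathrm{id}}$ converge weakly to a probability measure on $X_{\mathrm{id}}$. This $(b_n)$ is fixed. Measures $\nu_z$. In this setting there is a sequence $s_k\searrow\rho$ (fixed from now on) such that for every $z\in X$ there is a $\sigma$-finite measure $\nu_z$ on $X$ with $\int f\,d\nu_z=\lim_k\frac1{\mathcal P(s_k)}\sum_nb_ns_k^{-n}(\mathcal L_\varphi^nf)(z)$ for all non-negative continuous $f$, and the $\nu_z$ are pairwise equivalent. Fix $\xi_0\in X_{\mathrm{id}}$, put $\nu_{\mathbf o}=\nu_{\xi_0}$ and $\mathbb K(\delta_z,\cdot)=d\nu_z/d\nu_{\mathbf o}$. Spaces and maps. For $f:X\to\mathbb R$, $C_n(f)=\inf\{C:|f(z_1)-f(z_2)|\le C|f(z_1)|\ \forall z_1,z_2\in[w,g],\,w\in\mathcal W^n,\,g\in G\}$, and $\mathcal C=\{f:X\to\mathbb R:\ \nu_{\mathbf o}(|f|)<\infty,\ \lim_nC_n(f)=0\}$. With the convention $0/0=1$ inside $LD$, $$D_x(f)=\sup\Big\{\tfrac{|f(x)-f(z)|}{d_r(x,z)}:0<d_r(x,z)<1\Big\},\qquad LD(f)=\sup\Big\{\Big|\tfrac{f(z_1)}{f(z_2)}-1\Big|\Big/d_r(z_1,z_2):0<d_r(z_1,z_2)<1\Big\}.$$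 $\mathcal H^+=\{f:X\to[0,\infty):\mathcal L_\varphi(f)=\rho f,\ LD(f)<\infty\}$, $\mathcal H=\{f:X\to\mathbb R:\mathcal L_\varphi(f)=\rho f,\ \exists h\in\mathcal H^+\text{ with }D_x(f)\le h(x)\ \forall x\in X\}$. For $f\in\mathcal C$, $\Theta(f)(z)=\nu_z(f)=\int f\,d\nu_z=\int\mathbb K(\delta_z,y)f(y)\,d\nu_{\mathbf o}(y)$. $$C_\varphi=\sup\Big\{\Big|\tfrac{\Phi_n\circ\tau_v(z_1)}{\Phi_n\circ\tau_v(z_2)}-1\Big|\Big/d_r(z_1,z_2): n\in\mathbb N,\ v\in\mathcal W^n,\ z_1,z_2\in \theta^n([v])\times G,\ 0<d_r(z_1,z_2)<1\Big\}<\infty.$$ *)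

(* Defs.v *)
From HB Require Import structures.
From mathcomp Require Import all_boot all_order all_algebra.
From mathcomp Require Import all_classical all_reals all_analysis.
From mathcomp Require Import measurable_realfun.

Set Implicit Arguments.
Unset Strict Implicit.
Unset Printing Implicit Defensive.

Import Order.TTheory GRing.Theory Num.Theory.
Import numFieldNormedType.Exports.

Local Open Scope classical_set_scope.
Local Open Scope ring_scope.

(* [adj i j] stands for a_ij = 1. *)
Record markov_shift := MarkovShift {
  alphabet : countType;
  adj : rel alphabet;
  alphabet_inhabited : inhabited alphabet;
  adj_row : forall i : alphabet, exists j, adj i j;
  adj_col : forall j : alphabet, exists i, adj i j }.

(* Sequences are indexed from 0: the letter x_k of the mathematical text is
   [sval x k.-1]. *)
Definition admissible_seqs (M : markov_shift) :
    set (prod_topology (fun _ : nat => discrete_topology (alphabet M))) :=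
  [set w | forall k, @adj M (w k) (w k.+1)].

Definition shift_space (M : markov_shift) : Type :=
  set_type (@admissible_seqs M).

HB.instance Definition _ (M : markov_shift) :=
  Topological.copy (shift_space M) (set_type (@admissible_seqs M)).

Lemma shift_space_inhabited (M : markov_shift) : exists x : shift_space M, True.
Proof.
have [w0] := alphabet_inhabited M.
have [f fP] := choice (@adj_row M).
have w_in : (fun k => iter k f w0) \in @admissible_seqs M.
  by apply/mem_set => k /=; exact: fP.
by exists (exist (fun w => w \in @admissible_seqs M) _ w_in).
Qed.

(* Pointedness is only there because measurable types must be pointed. *)
HB.instance Definition _ (M : markov_shift) :=
  isPointed.Build (shift_space M) (projT1 (cid (shift_space_inhabited M))).

Notation borel T := (g_sigma_algebraType (@open T)).

Section Shift.
Context (R : realType) (M : markov_shift).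
Local Notation W := (alphabet M).
Local Notation S := (shift_space M).
Implicit Types (x y : S) (v w : seq W) (n : nat).

Definition letter x : nat -> W := fun k => sval x k.

Lemma theta_subproof x :
  (fun k => letter x k.+1) \in @admissible_seqs M.
Proof. by apply/mem_set => k /=; case: x => x /= /set_mem; exact. Qed.

Definition theta x : S := exist _ (fun k => letter x k.+1) (theta_subproof x).

Definition words n : set (seq W) := [set v | size v = n /\ sorted (@adj M) v].

Definition cyl v : set S := [set x | mkseq (letter x) (size v) = v].

(* theta^n([v]) for v of length n, the domain of tau_v *)
Definition image_cyl v : set S := iter (size v) theta @` cyl v.

(* The inverse of theta^n restricted to [v]; junk value outside theta^n([v]) *)
Definition tau v x : S :=
  xget x (cyl v `&` [set y | iter (size v) theta y = x]).

Definition topologically_mixing : Prop :=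
  forall a b : W, exists N, forall n, (N <= n)%N ->
    (iter n theta @` cyl [:: a]) `&` cyl [:: b] !=set0.

Definition bip : Prop :=
  topologically_mixing /\
  exists I : seq W, forall v : W, exists b1 b2 : W,
    [/\ b1 \in I, b2 \in I, words 2 [:: v; b1] & words 2 [:: b2; v]].

Definition oscillation n (f : S -> R) : \bar R :=
  ereal_sup [set (`|f p.1 - f p.2|)%:E | p in
    [set p : S * S | forall i, (i < n)%N -> letter p.1 i = letter p.2 i]].

Definition locally_hoelder (r : R) (f : S -> R) : Prop :=
  exists2 C : R, 0 < C &
    forall n, (1 <= n)%N -> (oscillation n f <= (C * r ^+ n)%:E)%E.

Definition birkhoff_prod (phi : S -> R) n x : R :=
  \prod_(k < n) phi (iter k theta x).

(* L_phi on functions with values in [0, +oo] *)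
Definition transfer (phi : S -> R) (f : S -> \bar R) x : \bar R :=
  \esum_(v in [set v : W | image_cyl [:: v] x])
    ((phi (tau [:: v] x))%:E * f (tau [:: v] x))%E.

Definition gurevich_pressure (phi : S -> R) (a : W) : \bar R :=
  limn_esup (fun n => ((n%:R^-1)%:E *
    lne (\esum_(x in [set x | iter n theta x = x /\ cyl [:: a] x])
           (birkhoff_prod phi n x)%:E))%E).

(* L_phi^* m = m *)
Definition transfer_invariant (phi : S -> R) (m : set (borel S) -> \bar R) :
    Prop :=
  forall f : borel S -> \bar R,
    measurable_fun setT f -> (forall x, (0 <= f x)%E) ->
    (\int[m]_x transfer phi f x = \int[m]_x f x)%E.

(* J is a (strictly positive) version of d(m o tau_v)/dm on theta^n([v]). *)
Definition jacobian_version (m : set (borel S) -> \bar R) v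
    (J : borel S -> R) : Prop :=
  [/\ measurable_fun (image_cyl v : set (borel S)) J,
      forall x, image_cyl v x -> 0 < J x
    & forall B : set (borel S), measurable B -> B `<=` image_cyl v ->
        (m (tau v @` B) = \int[m]_(x in B) (J x)%:E)%E].

(* Jacobians are only defined up to null sets, so the pointwise distortion
   bound is required of some version of them. *)
Definition gibbs_markov (m : set (borel S) -> \bar R) : Prop :=
  [/\ forall (w : W) (B : set (borel S)), measurable B ->
        B `<=` image_cyl [:: w] ->
        (m B = 0%E <-> m (tau [:: w] @` B) = 0%E),
      (0 < ereal_inf (range (fun w : W => m (image_cyl [:: w]))))%E
    & exists r C : R, [/\ 0 < r < 1, 0 < C &
        forall k v, (1 <= k)%N -> words k v ->
        exists2 J, jacobian_version m v J &
          forall n w, (1 <= n)%N -> words n w -> words (k + n) (v ++ w) ->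
          forall x y, cyl w x -> cyl w y ->
            `|ln (J x) - ln (J y)| <= C * r ^+ n]].

End Shift.

Definition discrete_group (G : groupType) : Type := discrete_topology G.
HB.instance Definition _ (G : groupType) :=
  Topological.copy (discrete_group G) (discrete_topology G).
HB.instance Definition _ (G : groupType) := isPointed.Build (discrete_group G) (1%g : G).

Definition extension (M : markov_shift) (G : groupType) : Type :=
  (shift_space M * discrete_group G)%type.
HB.instance Definition _ (M : markov_shift) (G : groupType) :=
  Topological.copy (extension M G) (shift_space M * discrete_group G)%type.
HB.instance Definition _ (M : markov_shift) (G : groupType) :=
  Pointed.copy (extension M G) (shift_space M * discrete_group G)%type.

Section Extension.
Context (R : realType) (M : markov_shift) (G : groupType).
Local Notation W := (alphabet M).
Local Notation S := (shift_space M).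
Local Notation X := (extension M G).
Context (phi : S -> R) (psi : S -> G).
Implicit Types (x y : S) (z : X) (v w : seq W) (g h : G) (n : nat).

Definition mkX x g : X := (x, g).
Definition base z : S := z.1.
Definition fiber z : G := z.2.

Definition cocycle n x : G :=
  \big[*%g/1%g]_(k < n) psi (iter k (@theta M) x).

Definition ext_map z : X := mkX (theta (base z)) (fiber z * psi (base z))%g.

Definition sheet g : set X := [set z | fiber z = g].

Definition ext_cyl w g : set X := [set z | cyl w (base z) /\ fiber z = g].

(* psi_v is the value of psi_n at tau_v x, which is a point of [v]. *)
Definition ext_tau v z : X :=
  mkX (tau v (base z))
      (fiber z * (cocycle (size v) (tau v (base z)))^-1)%g.

Definition ext_transitive : Prop :=
  forall (a b : W) g h, exists2 n, (1 <= n)%N &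
    (iter n ext_map @` ext_cyl [:: a] g) `&` ext_cyl [:: b] h !=set0.

(* The lifted operator, on functions with values in [0, +oo] *)
Definition ext_transfer (f : X -> \bar R) z : \bar R :=
  \esum_(v in [set v : W | image_cyl [:: v] (base z)])
    ((phi (base (ext_tau [:: v] z)))%:E * f (ext_tau [:: v] z))%E.

(* L f = c f for real-valued f. The sum over the alphabet is unordered; as the
   right-hand side is finite (and +oo - +oo = -oo), the equality entails
   absolute convergence. *)
Definition eigenfunction (c : R) (f : X -> R) : Prop :=
  forall z, (ext_transfer (EFin \o f)^\+ z - ext_transfer (EFin \o f)^\- z
             = (c * f z)%:E)%E.

Definition first_diff x y : nat :=
  xget 0%N [set j | letter x j <> letter y j /\
                    forall i, (i < j)%N -> letter x i = letter y i].

(* With letters indexed from 0, min{i : x_i <> y_i} - 1 is [first_diff x y]. *)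
Definition shift_dist (r : R) z1 z2 : R :=
  if z1 == z2 then 0
  else if fiber z1 == fiber z2 then r ^+ first_diff (base z1) (base z2)
  else 1.

Definition D_at (r : R) (f : X -> R) z : \bar R :=
  ereal_sup [set (`|f z - f z'| / shift_dist r z z')%:E | z' in
    [set z' | 0 < shift_dist r z z' < 1]].

(* Quotient with the conventions 0/0 = 1 and a/0 = oo for a <> 0 *)
Definition quot (a b : R) : \bar R :=
  if b == 0 then (if a == 0 then 1%E else +oo%E) else (a / b)%:E.

Definition LD (r : R) (f : X -> R) : \bar R :=
  ereal_sup
    [set (`|quot (f p.1) (f p.2) - 1| * ((shift_dist r p.1 p.2)^-1)%:E)%E
    | p in [set p : X * X | 0 < shift_dist r p.1 p.2 < 1]].

Definition C_phi (r : R) : \bar R :=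
  ereal_sup [set e | exists n v z1 z2,
    [/\ (1 <= n)%N, words n v,
        image_cyl v (base z1) /\ image_cyl v (base z2),
        0 < shift_dist r z1 z2 < 1
      & e = (`|birkhoff_prod phi n (base (ext_tau v z1)) /
               birkhoff_prod phi n (base (ext_tau v z2)) - 1|
             / shift_dist r z1 z2)%:E]].

Definition return_sum (xi : S) n : \bar R :=
  iter n ext_transfer (EFin \o \1_(sheet 1%g)) (mkX xi 1%g).

Definition rho (xi : S) : R :=
  fine (limn_esup (fun n => poweR (return_sum xi n) n%:R^-1)).

Definition weight (lambda : nat -> R) n : R :=
  \prod_(1 <= k < n.+1) lambda k.

Definition poincare (xi : S) (b : nat -> R) (s : R) : \bar R :=
  (\sum_(1 <= n <oo) ((s ^- n * b n)%:E * return_sum xi n))%E.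

Definition admissible_weights (xi : S) (lambda : nat -> R) : Prop :=
  [/\ forall k, (1 <= k)%N -> 1 <= lambda k,
      forall k, (1 <= k)%N -> lambda k.+1 <= lambda k,
      lambda k @[k --> \oo] --> (1 : R),
      forall s, 0 < s <= rho xi -> poincare xi (weight lambda) s = +oo%E
    & forall s, rho xi < s -> (poincare xi (weight lambda) s < +oo)%E].

(* s_k decreases to rho, staying above it so that P(s_k) is finite *)
Definition decreases_to_rho (xi : S) (s : nat -> R) : Prop :=
  [/\ forall k, rho xi < s k, forall k, s k.+1 <= s k
    & s k @[k --> \oo] --> rho xi].

(* The measure m_s *)
Definition orbit_measure (xi : S) (b : nat -> R) (s : R)
    (A : set (borel X)) : \bar R :=
  (((fine (poincare xi b s))^-1)%:E *
   \sum_(1 <= n <oo) ((s ^- n * b n)%:E *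
     \esum_(z in [set z | iter n ext_map z = mkX xi 1%g])
       ((birkhoff_prod phi n (base z))%:E * \d_(z : borel X) A)))%E.

(* A probability measure on the clopen set X_id is rendered as one on X which
   gives it full mass. *)
Definition property_C (xi : S) (b : nat -> R) : Prop :=
  exists s : nat -> R, decreases_to_rho xi s /\
  exists2 m : probability (borel X) R, m (sheet 1%g) = 1%E &
    forall f : X -> R, continuous f -> (exists c, forall z, `|f z| <= c) ->
      (\int[orbit_measure xi b (s k)]_(z in sheet 1%g) (f z)%:E
         @[k --> \oo] --> \int[m]_(z in sheet 1%g) (f z)%:E)%E.

Definition nu_family (xi : S) (b s : nat -> R)
    (nu : X -> {sigma_finite_measure set (borel X) -> \bar R}) : Prop :=
  (forall z (f : X -> R), continuous f -> (forall z', 0 <= f z') ->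
    (((fine (poincare xi b (s k)))^-1)%:E *
       \sum_(1 <= n <oo) ((b n * (s k) ^- n)%:E *
                          iter n ext_transfer (EFin \o f) z)
       @[k --> \oo] --> \int[nu z]_z' (f z')%:E)%E) /\
  (forall z z', nu z `<< nu z').

(* C_n(f), the infimum being over nonnegative constants *)
Definition C_const n (f : X -> R) : \bar R :=
  ereal_inf [set C%:E | C in [set C : R | 0 <= C /\
    forall w g, words n w -> forall z1 z2, ext_cyl w g z1 -> ext_cyl w g z2 ->
      `|f z1 - f z2| <= C * `|f z1|]].

Definition space_C (nu_o : set (borel X) -> \bar R) : set (X -> R) :=
  [set f | (\int[nu_o]_z (`|f z|)%:E < +oo)%E /\
           C_const n f @[n --> \oo] --> 0%E].

Definition H_plus (xi : S) (r : R) : set (X -> R) :=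
  [set f | [/\ forall z, 0 <= f z, eigenfunction (rho xi) f
             & (LD r f < +oo)%E]].

Definition H_space (xi : S) (r : R) : set (X -> R) :=
  [set f | eigenfunction (rho xi) f /\
     exists2 h, H_plus xi r h & forall z, (D_at r f z <= (h z)%:E)%E].

(* Only meaningful when f is integrable for each nu_z *)
Definition Theta (nu : X -> {sigma_finite_measure set (borel X) -> \bar R})
    (f : X -> R) (z : X) : R :=
  \int[nu z]_z' f z'.

End Extension.

(* Main.v *)
Require Import Defs.
From HB Require Import structures.
From mathcomp Require Import all_boot all_order all_algebra.
From mathcomp Require Import all_classical all_reals all_analysis.
From mathcomp Require Import measurable_realfun.
From mathcomp Require Import finmap ring lra.
Import Order.TTheory GRing.Theory Num.Theory.
Import numFieldNormedType.Exports.
Local Open Scope classical_set_scope.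
Local Open Scope ring_scope.

Set Implicit Arguments.
Unset Strict Implicit.
Unset Printing Implicit Defensive.

(** Write L for the transfer operator on the extension, T for the skew product,
    o for the point (xi, id), and Lambda_k F z for the normalized Green function (ngreen)
      P(s_k)^-1 * sum_n b_n s_k^-n (L^n F)(z),
    whose limit along k is nu_z(F) when F >= 0 is continuous.

    Regularity of Theta f.  Two points that agree in j >= 1 letters have the
    same backward branches, and the weights Phi_n along corresponding branches
    differ at most by a factor exp(D r^j), because the logarithm of phi is
    Hoelder continuous (iter_transfer_distortion).  A function of the class C
    varies by a factor 1 + o(1) on long cylinders, so L^n f inherits the same
    comparison up to an error that disappears as n grows.  Since P(s_k) tends to
    infinity, finitely many n do not matter in the limit, and nu_z(f) is Lipschitz
    in z relative to nu_z(|f|) (nuint_lipschitz, nuint_diff_le).  The required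
    dominating function of H^+ is therefore a multiple of Theta |f|.

    Harmonicity of Theta f.  For f >= 0 the inequality L (Theta f) <= rho Theta f
    is Fatou's lemma (nuint_superharmonic).  The converse requires that no mass
    of the last step of the backward orbits escapes to infinity in the alphabet.
    For f the indicator of a sheet this is seen by rotating words: a backward
    orbit u a from z to X_h, whose letter next to z is a, is turned into a backward
    orbit a d u c from o to X_id by means of connecting words d and c, finitely
    many of which suffice by the b.i.p. property; the weights change by a bounded
    factor (rotation).  Hence the mass of the last steps outside a finite set of
    letters is bounded by the mass of the cylinders [a, id] over these letters
    under Lambda_k at o (last_step_tail_le).  But nu_o(X_id) = 1 and the indicators
    of [a, id] are continuous, so that these masses are tight and the sheets
    satisfy L (Theta f) = rho Theta f (sheet_harmonic).  Since L (Theta g) <=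
    rho Theta g for every continuous g >= 0, equality passes from a function to
    everything continuous below it; as every continuous f >= 0 is an increasing
    limit of continuous functions dominated by finite combinations of sheets,
    monotone convergence for nu_z gives the equality in general
    (nuint_harmonic).

    Positive elements of H.  If f >= 0 and D_z(f) <= h(z) with h in H^+, expand
    rho^n f = L^n f and rho^n h = L^n h over backward branches of length n.  On
    branches the distance d(z1, z2) shrinks to r^n d(z1, z2), so the variation of
    f contributes at most r^n d(z1, z2) rho^n h(z1), while the variation of the
    weights contributes the factor 1 + C_phi d(z1, z2).  Dividing by rho^n and
    letting n tend to infinity leaves f(z1) <= (1 + C_phi d(z1, z2)) f(z2), which
    is the bound on LD (harmonic_LD).  The division is legitimate since rho > 0:
    otherwise the Poincare series would be finite for every s > 0, although a
    single loop at o makes it infinite for small s (rho_gt0). *)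

(** * Points of the shift space *)

Section ShiftPoints.
Context (M : markov_shift).
Local Notation S := (shift_space M).
Implicit Types (x y : S) (n k : nat).

Lemma shift_point_ext x y : (forall k, letter x k = letter y k) -> x = y.
Proof. by move=> xy; apply: val_inj; apply/funext => k; exact: xy. Qed.

Lemma letter_adj x k : adj (letter x k) (letter x k.+1).
Proof. by case: x => x /= /[dup] xP /set_mem; apply. Qed.

Lemma letter_iter n x k : letter (iter n (@theta M) x) k = letter x (n + k)%N.
Proof.
by elim: n k => // n IH k; rewrite iterS addSnnS -IH.
Qed.

Lemma mk_point (u : nat -> alphabet M) : (forall k, adj (u k) (u k.+1)) ->
  exists x : S, forall k, letter x k = u k.
Proof.
move=> uP; have uin : u \in @admissible_seqs M by apply/mem_set.
by exists (exist _ u uin).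
Qed.

(** Concatenation of words and points. The index n instead of n + 1 excludes the
    empty word, for which the condition at the junction makes no sense. *)
Lemma splice n y x : adj (letter y n) (letter x 0) ->
  exists p, (forall i, (i <= n)%N -> letter p i = letter y i) /\
            iter n.+1 (@theta M) p = x.
Proof.
move=> yx.
pose u k := if (k <= n)%N then letter y k else letter x (k - n.+1).
have [k|p pE] := @mk_point u.
  rewrite /u; case: (ltngtP k n) => [kn|kn|->].
  - exact: letter_adj.
  - by rewrite subSn// ; exact: letter_adj.
  - by rewrite subnn.
exists p; split => [i ilen|]; first by rewrite pE /u ilen.
apply: shift_point_ext => k; rewrite letter_iter pE /u.
by rewrite addSn ltnNge leq_addr /= subSS addKn.
Qed.

Lemma cons_point (a : alphabet M) x : adj a (letter x 0) ->
  exists p, letter p 0 = a /\ theta p = x.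
Proof.
move=> ax; pose u k := if k is j.+1 then letter x j else a.
have [[|k]//=|p pE] := @mk_point u; first exact: letter_adj.
by exists p; split; [rewrite pE|apply: shift_point_ext => k; rewrite -[LHS]/(letter p k.+1) pE].
Qed.

Lemma theta_inj x y : letter x 0 = letter y 0 -> theta x = theta y -> x = y.
Proof.
move=> xy0 xy; apply: shift_point_ext => -[//|k].
by rewrite -[LHS]/(letter (theta x) k) xy.
Qed.

Lemma cylP (v : seq (alphabet M)) x : cyl v x <->
  forall i, (i < size v)%N -> forall a, letter x i = nth a v i.
Proof.
split=> [xv i iv a|xv]; first by rewrite -[in RHS]xv nth_mkseq.
rewrite /cyl /=.
case: v xv => // a v xv; apply: (@eq_from_nth _ a); rewrite size_mkseq// => i iv.
by rewrite nth_mkseq// (xv _ iv a).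
Qed.

Lemma cyl_mkseq x y n :
  cyl (mkseq (letter x) n) y <-> forall i, (i < n)%N -> letter y i = letter x i.
Proof.
rewrite cylP size_mkseq; split=> xy i iltn => [|a].
  by rewrite (xy _ iltn (letter x i)) nth_mkseq.
by rewrite xy// nth_mkseq.
Qed.

Lemma words_mkseq x n : words n (mkseq (letter x) n).
Proof.
split; first by rewrite size_mkseq.
apply/(sortedP (letter x 0)) => i; rewrite size_mkseq => i1n.
by rewrite !nth_mkseq//; [exact: letter_adj|exact: ltnW].
Qed.

Lemma image_cyl1 (a : alphabet M) x : image_cyl [:: a] x <-> adj a (letter x 0).
Proof.
split=> [[y /cylP/(_ 0 isT a)/= <- <-]|/cons_point[p [p0 <-]]].
  exact: letter_adj.
by exists p => //; apply/cylP => -[|]//= _ b.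
Qed.

Lemma tauP v x : image_cyl v x ->
  cyl v (tau v x) /\ iter (size v) (@theta M) (tau v x) = x.
Proof. by move=> [y yv yx]; apply: (@xgetPex _ x (cyl v `&` _)); exists y. Qed.

Lemma iter_theta_inj n x y : (forall i, (i < n)%N -> letter x i = letter y i) ->
  iter n (@theta M) x = iter n (@theta M) y -> x = y.
Proof.
move=> xy0 xy; apply: shift_point_ext => k.
have [/xy0//|nk] := ltnP k n.
by rewrite -(subnKC nk) -!letter_iter xy.
Qed.

Lemma tau_mkseq y n : tau (mkseq (letter y) n) (iter n (@theta M) y) = y.
Proof.
have yc : image_cyl (mkseq (letter y) n) (iter n (@theta M) y).
  by exists y; [apply/cyl_mkseq|rewrite size_mkseq].
have [] := tauP yc; rewrite size_mkseq => /cyl_mkseq yE tE.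
exact: iter_theta_inj tE.
Qed.

End ShiftPoints.

(** * The group extension and its inverse branches *)

Section Extension.
Context (R : realType) (M : markov_shift) (G : groupType).
Local Notation S := (shift_space M).
Local Notation X := (extension M G).
Context (phi : S -> R) (psi : S -> G).
Hypothesis psi_cyl : forall x y, letter x 0%N = letter y 0%N -> psi x = psi y.
Implicit Types (x y : S) (z : X) (n k j : nat).
Local Notation T := (ext_map psi).
Local Notation Phi := (birkhoff_prod phi).

(** Membership in a common cylinder, as a relation between points, so that words
    need not be mentioned. *)
Definition agree n z1 z2 := fiber z1 = fiber z2 /\
  forall i, (i < n)%N -> letter (base z1) i = letter (base z2) i.

Lemma agree_sym n z1 z2 : agree n z1 z2 -> agree n z2 z1.
Proof. by case=> fE lE; split=> [|i /lE]. Qed.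

Lemma agreeW n m z1 z2 : (m <= n)%N -> agree n z1 z2 -> agree m z1 z2.
Proof. by move=> mn [fE lE]; split=> // i im; apply: lE; exact: leq_trans mn. Qed.

Lemma ext_eq z1 z2 : base z1 = base z2 -> fiber z1 = fiber z2 -> z1 = z2.
Proof. by case: z1 z2 => [x1 g1] [x2 g2] /= -> ->. Qed.

Lemma cocycleS n x : cocycle psi n.+1 x = (psi x * cocycle psi n (theta x))%g.
Proof.
by rewrite /cocycle big_ord_recl; congr (_ * _)%g; apply: eq_bigr => i _; rewrite -iterSr.
Qed.

Lemma birkhoffS n x : Phi n.+1 x = phi x * Phi n (theta x).
Proof.
by rewrite /birkhoff_prod big_ord_recl; congr (_ * _); apply: eq_bigr => i _; rewrite -iterSr.
Qed.

Lemma birkhoffSr n x : Phi n.+1 x = Phi n x * phi (iter n (@theta M) x).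
Proof. by rewrite /birkhoff_prod big_ord_recr. Qed.

Lemma cocycle_ext n x y : (forall i, (i < n)%N -> letter x i = letter y i) ->
  cocycle psi n x = cocycle psi n y.
Proof.
move=> xy; apply: eq_bigr => i _; apply: psi_cyl.
by rewrite !letter_iter addn0 xy.
Qed.

Lemma iter_ext_map n z :
  iter n T z = mkX (iter n (@theta M) (base z)) (fiber z * cocycle psi n (base z))%g.
Proof.
elim: n z => [|n IH] z; first by rewrite /cocycle big_ord0 mulg1; case: z.
by rewrite iterSr IH /= cocycleS mulgA -iterS iterSr.
Qed.

Lemma base_iter n z : base (iter n T z) = iter n (@theta M) (base z).
Proof. by rewrite iter_ext_map. Qed.

Lemma fiber_iter n z :
  fiber (iter n T z) = (fiber z * cocycle psi n (base z))%g.
Proof. by rewrite iter_ext_map. Qed.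

(** The preimage of z under the skew product whose first letter is a; when a
    cannot precede the first letter of z, its value is meaningless. *)
Definition pre (a : alphabet M) z : X := ext_tau psi [:: a] z.

Section Pre.
Context (a : alphabet M) (z : X) (az : adj a (letter (base z) 0)).

Lemma letter_pre0 : letter (base (pre a z)) 0 = a.
Proof.
by have /image_cyl1/tauP[/cylP/(_ 0 isT a)] := az.
Qed.

Lemma theta_pre : theta (base (pre a z)) = base z.
Proof. by have /image_cyl1/tauP[] := az. Qed.

Lemma ext_map_pre : T (pre a z) = z.
Proof.
apply: ext_eq; first exact: theta_pre.
rewrite /= /cocycle big_ord1 /= -mulgA mulVg mulg1//.
Qed.

Lemma letter_preS k : letter (base (pre a z)) k.+1 = letter (base z) k.
Proof. by rewrite -theta_pre. Qed.

End Pre.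

(** Every point is an inverse branch of its image, so statements about the
    branches of T z apply to an arbitrary z. *)
Lemma pre_ext_map z : pre (letter (base z) 0) (T z) = z.
Proof.
have az : adj (letter (base z) 0) (letter (base (T z)) 0) by exact: letter_adj.
have bE : base (pre (letter (base z) 0) (T z)) = base z.
  by apply: theta_inj; rewrite ?letter_pre0 ?theta_pre.
have fE : (fiber (pre (letter (base z) 0) (T z)) *
  psi (base (pre (letter (base z) 0) (T z))) = fiber z * psi (base z))%g.
  exact: (congr1 (@fiber _ _) (ext_map_pre az)).
by apply: ext_eq => //; move: fE; rewrite bE => /mulIg.
Qed.

Lemma agree_pre j a z1 z2 : adj a (letter (base z1) 0) ->
  agree j.+1 z1 z2 -> agree j.+2 (pre a z1) (pre a z2).
Proof.
move=> az1 z12; have az2 : adj a (letter (base z2) 0).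
  by case: z12 => _ /(_ 0 isT) <-.
case: z12 => f12 l12.
have l0 : letter (base (pre a z1)) 0 = letter (base (pre a z2)) 0.
  by rewrite !letter_pre0.
split.
  rewrite /= f12; congr (_ * _^-1)%g.
  by rewrite /cocycle !big_ord1; exact: psi_cyl.
by case=> // i i2; rewrite !letter_preS// l12.
Qed.

End Extension.

(** * The transfer operator *)

Lemma esumZl (R : realType) (I : choiceType) (A : set I) (c : R)
    (a : I -> \bar R) : 0 <= c -> (forall i, A i -> 0 <= a i)%E ->
  (\esum_(i in A) (c%:E * a i) = c%:E * \esum_(i in A) a i)%E.
Proof.
move=> c0 a0; rewrite /esum -ereal_supZl//; last first.
  apply/set0P; exists (\sum_(i \in set0) a i)%E.
  by exists set0 => //; exact: fsets_set0.
rewrite image_comp; congr ereal_sup; apply: eq_imagel => B [finB BA] /=.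
rewrite !fsbig_finite//= [in LHS]big_seq [in RHS]big_seq ge0_sume_distrr// => i.
by rewrite in_fset_set// in_setE => /BA/a0.
Qed.

Section Transfer.
Context (R : realType) (M : markov_shift) (G : groupType).
Local Notation S := (shift_space M).
Local Notation X := (extension M G).
Context (phi : S -> R) (psi : S -> G).
Hypothesis phi_gt0 : forall x, 0 < phi x.
Hypothesis psi_cyl : forall x x' : S, letter x 0%N = letter x' 0%N -> psi x = psi x'.
Implicit Types (x : S) (y z : X) (n k j : nat) (F H : X -> \bar R).
Local Notation T := (ext_map psi).
Local Notation Phi := (birkhoff_prod phi).
Local Notation L := (ext_transfer phi psi).
Local Notation pre := (pre psi).

Definition pred_letters z : set (alphabet M) := [set a | adj a (letter (base z) 0)].

Lemma transferE F z :
  L F z = (\esum_(a in pred_letters z) ((phi (base (pre a z)))%:E * F (pre a z)))%E.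
Proof.
rewrite /ext_transfer; congr (esum _ _); apply/seteqP.
by split=> a /image_cyl1.
Qed.

Lemma transfer_term_ge0 F a z : (forall y, 0 <= F y)%E ->
  (0 <= (phi (base (pre a z)))%:E * F (pre a z))%E.
Proof. by move=> F0; rewrite mule_ge0// lee_fin ltW. Qed.

Lemma transfer_ge0 F z : (forall y, 0 <= F y)%E -> (0 <= L F z)%E.
Proof. by move=> F0; rewrite transferE esum_ge0// => a _; exact: transfer_term_ge0. Qed.

Lemma iter_transfer_ge0 n F z : (forall y, 0 <= F y)%E -> (0 <= iter n L F z)%E.
Proof.
by elim: n z => [//|n IH] z F0; rewrite iterS transfer_ge0// => y; exact: IH.
Qed.

Lemma le_transfer F H z : (forall y, F y <= H y)%E -> (L F z <= L H z)%E.
Proof.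
by move=> FH; rewrite !transferE le_esum// => a _; rewrite lee_pmul2l ?lte_fin.
Qed.

Lemma le_iter_transfer n F H z : (forall y, F y <= H y)%E ->
  (iter n L F z <= iter n L H z)%E.
Proof.
by elim: n z => [//|n IH] z FH; rewrite !iterS le_transfer// => y; exact: IH.
Qed.

Lemma transferD F H z : (forall y, 0 <= F y)%E -> (forall y, 0 <= H y)%E ->
  (L (fun y => F y + H y) z = L F z + L H z)%E.
Proof.
move=> F0 H0; rewrite !transferE -esumD; [|by move=> *; exact: transfer_term_ge0..].
by apply: eq_esum => a _; rewrite ge0_muleDr.
Qed.

Lemma iter_transferD n F H z : (forall y, 0 <= F y)%E -> (forall y, 0 <= H y)%E ->
  (iter n L (fun y => F y + H y) z = iter n L F z + iter n L H z)%E.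
Proof.
elim: n z => [//|n IH] z F0 H0; rewrite !iterS -transferD.
- by congr (L _ z); apply/funext => y; exact: IH.
- by move=> y; exact: iter_transfer_ge0.
- by move=> y; exact: iter_transfer_ge0.
Qed.

Lemma transferZ (c : R) F z : 0 <= c -> (forall y, 0 <= F y)%E ->
  (L (fun y => c%:E * F y) z = c%:E * L F z)%E.
Proof.
move=> c0 F0; rewrite !transferE -esumZl//; last by move=> *; exact: transfer_term_ge0.
by apply: eq_esum => a _; rewrite muleCA.
Qed.

Lemma iter_transferZ n (c : R) F z : 0 <= c -> (forall y, 0 <= F y)%E ->
  (iter n L (fun y => c%:E * F y) z = c%:E * iter n L F z)%E.
Proof.
elim: n z => [//|n IH] z c0 F0; rewrite !iterS -transferZ//.
- by congr (L _ z); apply/funext => y; exact: IH.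
- by move=> y; exact: iter_transfer_ge0.
Qed.

Lemma iter_transfer0 n z : iter n L (fun=> 0%E) z = 0%E.
Proof.
elim: n z => [//|n IH] z; rewrite iterS transferE esum1// => a _.
by rewrite IH mule0.
Qed.

Lemma iter_transfer_sum n (J : Type) (s : seq J) (F : J -> X -> \bar R) z :
  (forall i y, 0 <= F i y)%E ->
  (iter n L (fun y => \sum_(i <- s) F i y) z = \sum_(i <- s) iter n L (F i) z)%E.
Proof.
move=> F0; elim: s => [|i s IH].
  rewrite big_nil -[RHS](iter_transfer0 n z); congr (iter _ _ _ _).
  by apply/funext => y; rewrite big_nil.
rewrite big_cons -IH -iter_transferD//; last by move=> y; exact: sume_ge0.
by congr (iter _ _ _ _); apply/funext => y; rewrite big_cons.
Qed.

(** Keeping a single branch; its iterates below turn each orbit from y to z into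
    a lower bound for the iterates of the operator at z. *)
Lemma transfer_lower F y : (forall y, 0 <= F y)%E ->
  ((phi (base y))%:E * F y <= L F (T y))%E.
Proof.
move=> F0; rewrite transferE; apply: esum_ge; exists [set letter (base y) 0].
  by split; [exact: finite_set1|move=> _ ->; exact: letter_adj].
by rewrite fsbig_set1 pre_ext_map.
Qed.

Lemma birkhoff_gt0 n x : 0 < Phi n x.
Proof. by rewrite /birkhoff_prod prodr_gt0. Qed.

Lemma iter_transfer_lower n F y : (forall y, 0 <= F y)%E ->
  ((Phi n (base y))%:E * F y <= iter n L F (iter n T y))%E.
Proof.
move=> F0; elim: n => [|n IH].
  by rewrite /birkhoff_prod big_ord0 mul1e.
rewrite birkhoffSr !iterS.
apply: le_trans (transfer_lower _ _); last by move=> ?; exact: iter_transfer_ge0.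
by rewrite base_iter mulrC EFinM -muleA lee_pmul2l// lte_fin.
Qed.

Lemma iter_transfer_lowerD n m F y : (forall y, 0 <= F y)%E ->
  ((Phi n (base y))%:E * iter m L F y <= iter (n + m) L F (iter n T y))%E.
Proof.
move=> F0; rewrite iterD; apply: iter_transfer_lower => ?.
exact: iter_transfer_ge0.
Qed.

Definition ltrans (g : G) z : X := mkX (base z) (g * fiber z)%g.

Lemma pre_ltrans g a z : adj a (letter (base z) 0) ->
  pre a (ltrans g z) = ltrans g (pre a z).
Proof.
move=> az; apply: ext_eq => //=.
exact/esym/mulgA.
Qed.

(** Left translations of the group coordinate commute with the skew product,
    which multiplies by the cocycle on the right. *)
Lemma iter_transfer_ltrans n g F z :
  iter n L (fun y => F (ltrans g y)) z = iter n L F (ltrans g z).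
Proof.
elim: n z => [//|n IH] z; rewrite !iterS !transferE; apply: eq_esum => a az.
by rewrite IH pre_ltrans.
Qed.

End Transfer.

(** * Bounded distortion *)

Lemma geometric_sum_le (R : realType) (r : R) m n : 0 < r < 1 ->
  \sum_(i < n) r ^+ (m + i) <= r ^+ m / (1 - r).
Proof.
move=> /andP[r0 r1]; rewrite ler_pdivlMr ?subr_gt0//.
suff -> : (\sum_(i < n) r ^+ (m + i)) * (1 - r) = r ^+ m - r ^+ (m + n).
  by rewrite gerBl exprn_ge0// ltW.
elim: n => [|n IH]; first by rewrite big_ord0 mul0r addn0 subrr.
by rewrite big_ord_recr/= mulrDl IH addnS exprS; ring.
Qed.

Lemma hoelder_distortion (R : realType) (M : markov_shift)
    (phi : shift_space M -> R) (r : R) :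
  (forall x, 0 < phi x) -> locally_hoelder r (fun x => ln (phi x)) ->
  exists2 C : R, 0 < C & forall n x y, (1 <= n)%N ->
    (forall i, (i < n)%N -> letter x i = letter y i) ->
    phi x <= expR (C * r ^+ n) * phi y.
Proof.
move=> phi0 [C C0 HC]; exists C => // n x y n1 xy.
rewrite -[phi x]lnK ?posrE// -[phi y]lnK ?posrE// -expRD ler_expR -lerBlDr.
apply: le_trans (ler_norm _) _; rewrite -lee_fin.
apply: le_trans (HC n n1); apply: ereal_sup_ubound.
by exists (x, y).
Qed.

Section Distortion.
Context (R : realType) (M : markov_shift) (G : groupType).
Local Notation S := (shift_space M).
Local Notation X := (extension M G).
Context (phi : S -> R) (psi : S -> G) (r C : R).
Hypothesis phi_gt0 : forall x, 0 < phi x.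
Hypothesis psi_cyl : forall x x' : S, letter x 0%N = letter x' 0%N -> psi x = psi x'.
Hypothesis r01 : 0 < r < 1.
Hypothesis C_gt0 : 0 < C.
Hypothesis phi_dist : forall n x x', (1 <= n)%N ->
    (forall i, (i < n)%N -> letter x i = letter x' i) ->
    phi x <= expR (C * r ^+ n) * phi x'.
Implicit Types (x : S) (y z : X) (n k j : nat) (F H : X -> \bar R).
Local Notation T := (ext_map psi).
Local Notation Phi := (birkhoff_prod phi).
Local Notation L := (ext_transfer phi psi).
Local Notation pre := (pre psi).

Definition dist_const := C / (1 - r).
Local Notation D := dist_const.

Lemma dist_const_gt0 : 0 < D.
Proof. by rewrite divr_gt0// subr_gt0; case/andP: r01. Qed.

Lemma dist_sum_le j n :
  expR (C * \sum_(i < n) r ^+ (j.+1 + i)) <= expR (D * r ^+ j).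
Proof.
rewrite ler_expR /D mulrAC -mulrA ler_pM2l//.
apply: (le_trans (geometric_sum_le _ _ r01)).
have /andP[r0 r1] := r01.
rewrite ler_pM2r ?invr_gt0 ?subr_gt0// exprS ler_piMl ?exprn_ge0// ?ltW//.
Qed.

(** After i steps the orbits still agree in n + m - i letters, so that the
    errors in the logarithm form a geometric sum. *)
Lemma birkhoff_distortion n m x x' : (1 <= m)%N ->
  (forall i, (i < n + m)%N -> letter x i = letter x' i) ->
  Phi n x <= expR (D * r ^+ m) * Phi n x'.
Proof.
move=> m1 xx'; apply: (@le_trans _ _ (expR (C * \sum_(i < n) r ^+ (m.+1 + i)) * Phi n x')); last first.
  by rewrite ler_pM2r ?birkhoff_gt0// dist_sum_le.
elim: n x x' xx' => [|n IH] x x' xx'.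
  by rewrite /birkhoff_prod !big_ord0 mulr0 expR0 mulr1.
rewrite !birkhoffS big_ord_recr /= mulrDr expRD.
have h1 : phi x <= expR (C * r ^+ (m.+1 + n)) * phi x'.
  by apply: phi_dist => // i im; apply: xx'; apply: leq_trans im _; rewrite !addSn addnC.
have h2 : Phi n (theta x) <=
    expR (C * \sum_(i < n) r ^+ (m.+1 + i)) * Phi n (theta x').
  by apply: IH => i im; rewrite -[LHS]/(letter x i.+1) xx'.
apply: le_trans (ler_pM _ _ h1 h2) _; try exact/ltW.
  exact/ltW/birkhoff_gt0.
by rewrite le_eqVlt; apply/orP; left; apply/eqP; ring.
Qed.

(** Points with a common first letter have the same branches. Only the values of
    F and H on pairs that agree in n + j + 1 letters are compared, since these
    are the ends of corresponding branches. *)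
Lemma iter_transfer_distortion n j F H z1 z2 :
  (forall y, 0 <= F y)%E -> (forall y, 0 <= H y)%E -> agree j.+1 z1 z2 ->
  (forall y1 y2, agree (n + j.+1) y1 y2 -> F y1 <= H y2)%E ->
  (iter n L F z1 <= (expR (D * r ^+ j.+1))%:E * iter n L H z2)%E.
Proof.
move=> F0 H0 z12 FH.
apply: (@le_trans _ _ ((expR (C * \sum_(i < n) r ^+ (j.+2 + i)))%:E * iter n L H z2)%E); last first.
  rewrite lee_wpmul2r ?iter_transfer_ge0// lee_fin//.
  exact: dist_sum_le.
elim: n j z1 z2 z12 FH => [|n IH] j z1 z2 z12 FH.
  by rewrite big_ord0 mulr0 expR0 mul1e /=; exact: FH.
rewrite !iterS !transferE -esumZl; first last.
- by move=> a _; apply: transfer_term_ge0 => // y; exact: iter_transfer_ge0.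
- exact: expR_ge0.
have -> : pred_letters z2 = pred_letters z1.
  by case: z12 => _ /(_ 0 isT) zE; rewrite /pred_letters zE.
apply: le_esum => a az1.
have az12 := agree_pre psi_cyl az1 z12.
rewrite big_ord_recl addn0 mulrDr expRD.
under eq_bigr do rewrite /bump/= addnS -addSn.
have h1 : phi (base (pre a z1)) <= expR (C * r ^+ j.+2) * phi (base (pre a z2)).
  by apply: phi_dist => //; case: az12.
have h2 : (iter n L F (pre a z1) <=
    (expR (C * \sum_(i < n) r ^+ (j.+3 + i)))%:E * iter n L H (pre a z2))%E.
  by apply: IH => // y1 y2 y12; apply: FH; rewrite addSn -addnS.
apply: (@le_trans _ _ ((expR (C * r ^+ j.+2) * phi (base (pre a z2)))%:E * iter n L F (pre a z1))%E).
  by apply: lee_wpmul2r; [exact: iter_transfer_ge0|rewrite lee_fin].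
rewrite !EFinM -!muleA lee_wpmul2l ?lee_fin ?expR_ge0//.
by rewrite [leRHS]muleCA lee_wpmul2l ?lee_fin// ltW.
Qed.

End Distortion.

(** * Connecting orbits *)

Section Connecting.
Context (M : markov_shift) (G : groupType).
Local Notation S := (shift_space M).
Local Notation X := (extension M G).
Context (psi : S -> G).
Hypothesis psi_cyl : forall x x' : S, letter x 0%N = letter x' 0%N -> psi x = psi x'.
Hypothesis transitive : ext_transitive psi.
Local Notation T := (ext_map psi).

(** Transitivity for letters gives it for arbitrary cylinders and exact targets:
    start with the first letters of z1, follow an orbit provided by transitivity
    until the first letter of z2 appears, and continue with z2. *)
Lemma connecting (z1 z2 : X) N : exists y m,
  [/\ (1 <= m)%N, agree N.+1 y z1 & iter m T y = z2].
Proof.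
have [[//|n] _] := transitive (letter (base z1) N) (letter (base z2) 0)
  (fiber z1 * cocycle psi N (base z1))%g (fiber z2).
move=> [_ [[p [/cylP/(_ 0 isT) p0 pf] <-] [/cylP/(_ 0 isT) pn pnf]]].
have {}p0 : letter (base p) 0 = letter (base z1) N := p0 (letter (base z1) N).
have {}pn : letter (base p) n.+1 = letter (base z2) 0.
  have := pn (letter (base z2) 0).
  by rewrite base_iter letter_iter addn0.
(* the orbit p of the transitivity hypothesis, redirected into z2 *)
have [q [qp qz2]] : exists q, (forall i, (i <= n)%N -> letter q i = letter (base p) i) /\
    iter n.+1 (@theta M) q = base z2.
  by apply: splice; rewrite -pn; exact: letter_adj.
have q0 : letter q 0 = letter (base z1) N by rewrite qp.
have [w [wz1 wq]] : exists w, (forall i, (i <= N)%N -> letter w i = letter (base z1) i) /\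
    iter N.+1 (@theta M) w = theta q.
  by apply: splice; rewrite -q0; exact: letter_adj.
have {}wq : iter N (@theta M) w = q.
  by apply: theta_inj wq; rewrite letter_iter addn0 q0 wz1.
exists (mkX w (fiber z1)), (n.+1 + N)%N; split => //.
rewrite iterD; apply: ext_eq.
  by rewrite !base_iter /= wq.
rewrite !fiber_iter !base_iter /= wq -pnf fiber_iter pf.
congr (_ * _ * _)%g.
  by apply: cocycle_ext => // i iN; rewrite wz1// ltnW.
by apply: cocycle_ext => // i iN; rewrite qp.
Qed.

End Connecting.

(** * Green functions and the positivity of rho *)

Lemma ereal_cvg_le (R : realType) (u v : nat -> \bar R) (a b : \bar R) :
  u k @[k --> \oo] --> a -> v k @[k --> \oo] --> b ->
  (\forall k \near \oo, (u k <= v k)%E) -> (a <= b)%E.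
Proof.
move=> ua vb uv; rewrite -(cvg_lim _ ua)// -(cvg_lim _ vb)//.
by apply: lee_lim uv; apply/cvg_ex; [exists a|exists b].
Qed.

Lemma nneseries_term_le (R : realType) (u : nat -> \bar R) m n :
  (forall i, 0 <= u i)%E -> (m <= n)%N -> (u n <= \sum_(m <= i <oo) u i)%E.
Proof.
move=> u0 mn; apply: (@le_trans _ _ (\sum_(m <= i < n.+1) u i)%E).
  by rewrite big_nat_recr//= leeDr// sume_ge0.
exact: nneseries_lim_ge.
Qed.

(** The index starts at 1, so that a shift of the terms only drops some. *)
Lemma nneseries_shift_le (R : realType) (u : nat -> \bar R) m :
  (forall i, 0 <= u i)%E ->
  (\sum_(1 <= i <oo) u (i + m)%N <= \sum_(1 <= i <oo) u i)%E.
Proof.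
move=> u0; rewrite -nneseries_addn; last by move=> i; exact: u0.
rewrite -[leRHS]nneseries_addn//.
under [in leLHS]eq_eseriesr do rewrite -addnA.
rewrite (nneseries_addn (f := u))// (nneseries_addn (f := u))//.
rewrite (nneseries_split 1 m); last by move=> k _; exact: u0.
by rewrite leeDr// sume_ge0.
Qed.

Section Green.
Context (R : realType) (M : markov_shift) (G : groupType).
Local Notation S := (shift_space M).
Local Notation X := (extension M G).
Context (phi : S -> R) (psi : S -> G) (r C : R).
Hypothesis phi_gt0 : forall x, 0 < phi x.
Hypothesis psi_cyl : forall x x' : S, letter x 0%N = letter x' 0%N -> psi x = psi x'.
Hypothesis r01 : 0 < r < 1.
Hypothesis C_gt0 : 0 < C.
Hypothesis phi_dist : forall n x x', (1 <= n)%N ->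
    (forall i, (i < n)%N -> letter x i = letter x' i) ->
    phi x <= expR (C * r ^+ n) * phi x'.
Hypothesis transitive : ext_transitive psi.
Context (xi : S) (lambda : nat -> R) (s : nat -> R).
Hypothesis weights : admissible_weights phi psi xi lambda.
Hypothesis s_rho : decreases_to_rho phi psi xi s.
Implicit Types (x : S) (y z : X) (n k j : nat) (F H : X -> \bar R).
Local Notation T := (ext_map psi).
Local Notation Phi := (birkhoff_prod phi).
Local Notation L := (ext_transfer phi psi).
Local Notation b := (weight lambda).
Local Notation rho := (rho phi psi xi).
Local Notation E1 := (expR (dist_const r C * r)).

Lemma weightS n : b n.+1 = b n * lambda n.+1.
Proof. by rewrite /weight big_nat_recr. Qed.

Lemma weight_gt0 n : 0 < b n.
Proof.
elim: n => [|n IH]; first by rewrite /weight big_geq.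
rewrite weightS mulr_gt0// (lt_le_trans ltr01)//.
by have [+ _ _ _ _] := weights; apply.
Qed.

Lemma weight_leS n : b n <= b n.+1.
Proof.
by rewrite weightS ler_peMr ?(ltW (weight_gt0 _))//; have [+ _ _ _ _] := weights; apply.
Qed.

Lemma weight_le n m : b n <= b (n + m).
Proof.
elim: m => [|m IH]; first by rewrite addn0.
by rewrite addnS (le_trans IH)// weight_leS.
Qed.

Definition green (t : R) F z : \bar R :=
  (\sum_(1 <= n <oo) ((b n * t ^- n)%:E * iter n L F z))%E.

Lemma green_term_ge0 t F z n : 0 < t -> (forall y, 0 <= F y)%E ->
  (0 <= (b n * t ^- n)%:E * iter n L F z)%E.
Proof.
move=> t0 F0; rewrite mule_ge0 ?iter_transfer_ge0// lee_fin mulr_ge0//.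
  exact/ltW/weight_gt0.
by rewrite invr_ge0 exprn_ge0// ltW.
Qed.

Lemma green_ge0 t F z : 0 < t -> (forall y, 0 <= F y)%E -> (0 <= green t F z)%E.
Proof. by move=> t0 F0; apply: nneseries_ge0 => n _ _; exact: green_term_ge0. Qed.

Lemma le_green t F H z z' : 0 < t -> (forall y, 0 <= F y)%E ->
  (forall n, (1 <= n)%N -> iter n L F z <= iter n L H z')%E ->
  (green t F z <= green t H z')%E.
Proof.
move=> t0 F0 FH; apply: lee_lim.
- by apply: is_cvg_nneseries => n _ _; exact: green_term_ge0.
- apply: is_cvg_nneseries => n n1 _; apply: mule_ge0.
    rewrite lee_fin mulr_ge0//; first exact/ltW/weight_gt0.
    by rewrite invr_ge0 exprn_ge0// ltW.
  by apply: le_trans (FH _ n1); exact: iter_transfer_ge0.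
- apply: nearW => k; rewrite big_nat_cond [leRHS]big_nat_cond.
  apply: lee_sum => n /andP[/andP[n1 _] _].
  rewrite lee_wpmul2l ?FH// lee_fin mulr_ge0//; first exact/ltW/weight_gt0.
  by rewrite invr_ge0 exprn_ge0// ltW.
Qed.

Lemma greenZ t (c : R) F z : 0 < t -> 0 <= c -> (forall y, 0 <= F y)%E ->
  (green t (fun y => c%:E * F y) z = c%:E * green t F z)%E.
Proof.
move=> t0 c0 F0; rewrite /green -nneseriesZl; last first.
  by move=> n _; exact: green_term_ge0.
by apply: eq_eseriesr => n _; rewrite iter_transferZ// muleCA.
Qed.

Lemma greenD t F H z : 0 < t -> (forall y, 0 <= F y)%E -> (forall y, 0 <= H y)%E ->
  (green t (fun y => F y + H y) z = green t F z + green t H z)%E.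
Proof.
move=> t0 F0 H0; rewrite /green -nneseriesD; first last.
- by move=> n _ _; exact: green_term_ge0.
- by move=> n _ _; exact: green_term_ge0.
apply: eq_eseriesr => n _; rewrite iter_transferD// ge0_muleDr//;
  exact: iter_transfer_ge0.
Qed.

(** The weights b_n are nondecreasing, so replacing b_n by b_(n+m) is harmless. *)
Lemma green_shift t F z m : 0 < t -> (forall y, 0 <= F y)%E ->
  (\sum_(1 <= n <oo) ((b n * t ^- n)%:E * iter (n + m) L F z) <=
   (t ^+ m)%:E * green t F z)%E.
Proof.
move=> t0 F0.
have tm0 : 0 < t ^+ m by rewrite exprn_gt0.
have h := nneseries_shift_le m (fun n => green_term_ge0 z n t0 F0).
apply: (@le_trans _ _ ((t ^+ m)%:E * \sum_(1 <= n <oo) ((b (n + m) * t ^- (n + m))%:E * iter (n + m) L F z))%E); last first.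
  by rewrite lee_wpmul2l// lee_fin ltW.
rewrite -nneseriesZl; last by move=> n _; exact: green_term_ge0.
apply: lee_nneseries => [n _ _|n _].
  rewrite mule_ge0 ?iter_transfer_ge0// lee_fin mulr_ge0//; first exact/ltW/weight_gt0.
  by rewrite invr_ge0 exprn_ge0// ltW.
rewrite muleA -EFinM lee_wpmul2r ?iter_transfer_ge0// lee_fin.
have -> : t ^+ m * (b (n + m) * t ^- (n + m)) = b (n + m) * t ^- n.
  by rewrite exprD invfM mulrCA [t ^+ m * _]mulrC -mulrA mulVf ?mulr1// gt_eqF.
by rewrite ler_wpM2r ?weight_le// invr_ge0 exprn_ge0// ltW.
Qed.

Definition sheet1 (g : G) : X -> \bar R := EFin \o \1_(sheet g).

Lemma sheet1_ge0 g y : (0 <= sheet1 g y)%E.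
Proof. by rewrite lee_fin. Qed.

Lemma sheet1_agree g n y1 y2 : agree n y1 y2 -> sheet1 g y1 = sheet1 g y2.
Proof.
case=> f12 _; rewrite /sheet1 /= !indicE /sheet.
by congr ((nat_of_bool _)%:R%:E); apply/idP/idP; rewrite !in_setE /= f12.
Qed.

Lemma sheet1E g y : sheet1 g y = if fiber y == g then 1%E else 0%E.
Proof.
rewrite /sheet1 /= indicE; case: eqP => h.
  by rewrite mem_set.
by rewrite memNset.
Qed.

Local Notation o := (mkX xi (1%g : G)).
Local Notation Z n := (return_sum phi psi xi n).

Lemma poincareE t : poincare phi psi xi b t = green t (sheet1 1%g) o.
Proof. by apply: eq_eseriesr => n _; rewrite [_ * b n]mulrC. Qed.

Lemma return_sum_ge0 n : (0 <= Z n)%E.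
Proof. by apply: iter_transfer_ge0 => // y; exact: sheet1_ge0. Qed.

Lemma return_sum0 : Z 0 = 1%E.
Proof. by rewrite -[LHS]/(sheet1 1%g o) sheet1E eqxx. Qed.

(** A loop at o, of length m, can be appended to every loop of length n. *)
Lemma return_loop : exists m c, [/\ (1 <= m)%N, 0 < c :> R &
  forall n, (c%:E * Z n <= Z (m + n)%N)%E].
Proof.
have [y [m [m1 yo yT]]] := connecting psi_cyl transitive o o 0.
exists m, (Phi m (base y) * E1^-1); split => //.
  by rewrite mulr_gt0 ?birkhoff_gt0// invr_gt0 expR_gt0.
move=> n; rewrite /return_sum -yT.
apply: le_trans (iter_transfer_lowerD _ phi_gt0 _ _ _ (sheet1_ge0 1%g)).
rewrite EFinM -muleA lee_wpmul2l ?lee_fin ?(ltW (birkhoff_gt0 phi_gt0 _ _))// yT.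
rewrite lee_pdivrMl ?expR_gt0//.
have := iter_transfer_distortion phi_gt0 psi_cyl r01 C_gt0 phi_dist (n := n)
  (sheet1_ge0 1%g) (sheet1_ge0 1%g) (agree_sym yo).
by rewrite expr1; apply => y1 y2 y12; rewrite (sheet1_agree _ y12).
Qed.

(** The return sums along multiples k m of the length of a loop are at least c^k,
    so the terms of the series do not tend to 0 when t^m <= c. *)
Lemma poincare_infinite_small : exists2 t0, 0 < t0 &
  forall t, 0 < t <= t0 -> poincare phi psi xi b t = +oo%E.
Proof.
have [m [c [m1 c0 hc]]] := return_loop.
have hZ k : ((c ^+ k)%:E <= Z (k * m)%N)%E.
  elim: k => [|k IH]; first by rewrite mul0n return_sum0.
  rewrite mulSn exprS EFinM; apply: le_trans (hc _).
  by rewrite lee_wpmul2l// lee_fin ltW.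
(* t <= 1 and t <= c imply t^m <= c, as m >= 1 *)
exists (Num.min 1 c); first by rewrite lt_min ltr01.
move=> t /andP[t0]; rewrite le_min => /andP[t1 tc].
have tm : t ^+ m <= c.
  by apply: le_trans tc; case: m m1 {hc hZ} => // m _; rewrite exprS ler_piMr ?exprn_ile1// ltW.
rewrite poincareE; apply/eqP; rewrite -leye_eq leNgt; apply/negP => fin.
pose u n : \bar R := ((b n * t ^- n)%:E * Z n)%E.
have u0 n : (0 <= u n)%E by apply: green_term_ge0 => // y; exact: sheet1_ge0.
have ufin : (\sum_(0 <= n <oo) u n < +oo)%E.
  rewrite (nneseries_split 0 1)// big_nat1 lte_add_pinfty//.
  by rewrite /u return_sum0 mule1 ltry.
have : (\sum_(N <= n <oo) u n @[N --> \oo] --> 0)%E.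
  by apply: nneseries_tail_cvg.
move=> /fine_cvgP[_] /cvgrPdist_lt/(_ 1 ltr01) [N _ hN].
have := hN N (leqnn N); rewrite sub0r normrN /=.
apply/negP; rewrite -leNgt.
have tailfin : (\sum_(N <= n <oo) u n \is a fin_num)%E.
  rewrite ge0_fin_numE; last by apply: nneseries_ge0.
  apply: le_lt_trans ufin; rewrite [leRHS](nneseries_split 0 N)//.
  by rewrite leeDr// sume_ge0.
rewrite ger0_norm ?fine_ge0; last by apply: nneseries_ge0.
rewrite -lee_fin fineK//.
apply: le_trans (nneseries_term_le u0 (leq_pmulr N m1)).
rewrite /u; apply: (@le_trans _ _ ((t ^- (N * m))%:E * (c ^+ N)%:E)%E).
  rewrite -EFinM lee_fin mulrC ler_pdivlMr ?exprn_gt0// mul1r mulnC exprM.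
  by rewrite lerXn2r// nnegrE ?exprn_ge0// ltW.
apply: lee_pmul; rewrite ?lee_fin ?invr_ge0 ?exprn_ge0 ?(ltW t0) ?(ltW c0)//.
2: by [].
rewrite ler_peMl ?invr_ge0 ?exprn_ge0 ?(ltW t0)//.
by apply: le_trans (weight_le 0 _); rewrite /weight big_geq.
Qed.

(** Otherwise the Poincare series would be finite at every t > 0. *)
Lemma rho_gt0 : 0 < rho.
Proof.
have [t0 t00 inf] := poincare_infinite_small.
rewrite ltNge; apply/negP => rho0.
have [_ _ _ _ /(_ t0 (le_lt_trans rho0 t00))] := weights.
by rewrite inf ?t00 ?lexx.
Qed.

Lemma s_gt0 k : 0 < s k.
Proof. by have [/(_ k) h _ _] := s_rho; exact: lt_trans rho_gt0 h. Qed.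

Lemma s_le0 k : s k <= s 0.
Proof.
have [_ h _] := s_rho; elim: k => // k; exact: le_trans.
Qed.

Definition poincare_at k : R := fine (poincare phi psi xi b (s k)).

Lemma poincare_ge0 k : (0 <= poincare phi psi xi b (s k))%E.
Proof. by rewrite poincareE; apply: green_ge0 => [|y]; [exact: s_gt0|exact: sheet1_ge0]. Qed.

Lemma poincare_atE k : (poincare_at k)%:E = poincare phi psi xi b (s k).
Proof.
rewrite fineK// ge0_fin_numE; last exact: poincare_ge0.
by have [_ _ _ _] := weights; apply; have [] := s_rho.
Qed.

(** A partial sum at rho is large, since the series diverges there, and the
    partial sum at s_k is at least (rho / s_k)^N times as large. *)
Lemma poincare_at_infty (B : R) : \forall k \near \oo, B <= poincare_at k.
Proof.
wlog B0 : B / 0 < B.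
  move=> h; have := h (Num.max B 1); rewrite lt_max ltr01 orbT => /(_ isT).
  by apply: filterS => k; apply: le_trans; rewrite le_max lexx.
have : poincare phi psi xi b rho = +oo%E.
  by have [_ _ _ + _] := weights; apply; rewrite rho_gt0 lexx.
rewrite poincareE => Prho.
have term0 n : (0 <= (b n * rho ^- n)%:E * Z n)%E.
  by apply: green_term_ge0 => [|y]; [exact: rho_gt0|exact: sheet1_ge0].
have [N hN] : exists N, ((2 * B)%:E <= \sum_(1 <= n < N) ((b n * rho ^- n)%:E * Z n))%E.
  apply: contrapT => /forallNP h; have : (green rho (sheet1 1%g) o <= (2 * B)%:E)%E.
    apply: lime_le; first by apply: is_cvg_nneseries => n _ _.
    by apply: nearW => N; have /negP := h N; rewrite -ltNge => /ltW.
  by rewrite Prho leye_eq.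
have rs0 k : 0 < rho / s k <= 1.
  rewrite divr_gt0 ?rho_gt0 ?s_gt0//= ler_pdivrMr ?s_gt0// mul1r ltW//.
  by have [] := s_rho.
have : (rho / s k) ^+ N @[k --> \oo] --> (1 : R).
  have h : rho / s k @[k --> \oo] --> (1 : R).
    rewrite -(divff (lt0r_neq0 rho_gt0)); apply: cvgMl_tmp; apply: cvgV.
      exact: lt0r_neq0 rho_gt0.
    by have [] := s_rho.
  rewrite -(expr1n _ N); exact: (cvg_comp _ _ h (@exprn_continuous _ N 1)).
move=> /cvgr_ge /(_ (2^-1)) h; have {}h := h _; near=> k.
have h2 : 2^-1 <= (rho / s k) ^+ N by near: k; apply: h; lra.
rewrite -lee_fin poincare_atE poincareE.
apply: (@le_trans _ _ (\sum_(1 <= n < N) ((b n * s k ^- n)%:E * Z n))%E); last first.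
  apply: nneseries_lim_ge => n _ _.
  by apply: green_term_ge0 => [|y]; [exact: s_gt0|exact: sheet1_ge0].
apply: (@le_trans _ _ ((2^-1)%:E * \sum_(1 <= n < N) ((b n * rho ^- n)%:E * Z n))%E).
  rewrite -lee_pdivrMl; last by rewrite invr_gt0.
  by rewrite invrK.
rewrite ge0_sume_distrr; last by move=> n _.
rewrite big_nat_cond [leRHS]big_nat_cond; apply: lee_sum => n /andP[/andP[_ nN] _].
rewrite muleA -EFinM lee_wpmul2r ?return_sum_ge0// lee_fin.
rewrite mulrCA ler_wpM2l ?(ltW (weight_gt0 _))//.
rewrite ler_pdivrMr ?exprn_gt0 ?rho_gt0// mulrC -expr_div_n (le_trans h2)//.
have /andP[q0 q1] := rs0 k.
apply: ler_wiXn2l => //; [exact: ltW|exact: ltnW].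
Unshelve. all: by end_near. Qed.

End Green.

(** * Rotation of words *)

Section Rotation.
Context (R : realType) (M : markov_shift) (G : groupType).
Local Notation S := (shift_space M).
Local Notation X := (extension M G).
Context (phi : S -> R) (psi : S -> G) (r C : R).
Hypothesis phi_gt0 : forall x, 0 < phi x.
Hypothesis psi_cyl : forall x x' : S, letter x 0%N = letter x' 0%N -> psi x = psi x'.
Hypothesis r01 : 0 < r < 1.
Hypothesis C_gt0 : 0 < C.
Hypothesis phi_dist : forall n x x', (1 <= n)%N ->
    (forall i, (i < n)%N -> letter x i = letter x' i) ->
    phi x <= expR (C * r ^+ n) * phi x'.
Hypothesis transitive : ext_transitive psi.
Hypothesis shift_bip : bip M.
Implicit Types (x : S) (y z : X) (n k j : nat) (F H : X -> \bar R).
Local Notation T := (ext_map psi).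
Local Notation Phi := (birkhoff_prod phi).
Local Notation L := (ext_transfer phi psi).
Local Notation pre := (pre psi).
Local Notation E1 := (expR (dist_const r C * r)).
Local Notation sheet1 := (@sheet1 R M G).

Lemma point_from (a : alphabet M) : exists x : S, letter x 0 = a.
Proof.
have [n _ [_ [[p [/cylP/(_ 0 isT a) pa _] _] _]]] := transitive a a 1%g 1%g.
by exists (base p).
Qed.

Lemma phi_letter_dist x x' : letter x 0 = letter x' 0 -> phi x <= E1 * phi x'.
Proof.
move=> xx'; apply: (@le_trans _ _ (expR (C * r ^+ 1) * phi x')).
  by apply: phi_dist => // -[|//].
rewrite expr1 ler_pM2r// ler_expR ler_pM2r//; last by case/andP: r01.
have /andP[r0 r1] := r01.
rewrite /dist_const ler_pdivlMr ?subr_gt0// mulrBr mulr1 gerBl mulr_ge0// ltW//.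
Qed.

Lemma birkhoff_letter_dist n x x' : (forall i, (i <= n)%N -> letter x i = letter x' i) ->
  Phi n.+1 x <= E1 ^+ 2 * Phi n.+1 x'.
Proof.
move=> xx'; rewrite !birkhoffSr.
have h1 := birkhoff_distortion phi_gt0 r01 C_gt0 phi_dist (n := n) (ltnSn 0) (x := x) (x' := x').
rewrite expr1 in h1.
have {}h1 : Phi n x <= E1 * Phi n x'.
  by apply: h1 => i; rewrite addn1 ltnS; exact: xx'.
have h2 : phi (iter n (@theta M) x) <= E1 * phi (iter n (@theta M) x').
  by apply: phi_letter_dist; rewrite !letter_iter addn0 xx'.
apply: le_trans (ler_pM _ _ h1 h2) _.
- exact/ltW/birkhoff_gt0.
- exact/ltW.
- by rewrite le_eqVlt; apply/orP; left; apply/eqP; ring.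
Qed.

(** A word that can precede y can also precede some letter of the finite set I
    given by the b.i.p. property, because this only concerns its last letter.
    So the iterates at y are controlled by the iterates at finitely many points
    on the same sheet. *)
Lemma transfer_switch : exists I : seq (alphabet M),
  [/\ forall a, exists2 b, b \in I & adj b a &
  forall (p : alphabet M -> X), (forall b, letter (base (p b)) 0 = b) ->
  forall n g y, (forall b, fiber (p b) = fiber y) ->
  (iter n.+1 L (sheet1 g) y <=
   (E1 ^+ 2)%:E * \sum_(b <- I) iter n.+1 L (sheet1 g) (p b))%E].
Proof.
have [_ [I hI]] := shift_bip; exists I; split.
  move=> a; have [b1 [b2 [_ b2I _ [_ /=]]]] := hI a.
  by rewrite andbT => b2a; exists b2.
move=> p pb n g y py; rewrite iterS.
have term0 b a : (0 <= (phi (base (pre a (p b))))%:E *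
    iter n L (sheet1 g) (pre a (p b)))%E.
  apply: transfer_term_ge0 => // y'; apply: iter_transfer_ge0 => // y''; exact: sheet1_ge0.
have e20 : 0 <= E1 ^+ 2 by rewrite exprn_ge0// expR_ge0.
apply: (@le_trans _ _ (\esum_(a in [set: alphabet M]) ((E1 ^+ 2)%:E *
    \sum_(b <- I) (if a \in pred_letters (p b) then
    (phi (base (pre a (p b))))%:E * iter n L (sheet1 g) (pre a (p b)) else 0)))%E).
  rewrite transferE esum_mkcond; apply: le_esum => a _.
  have sum0 : (0 <= \sum_(b <- I) (if a \in pred_letters (p b) then
    (phi (base (pre a (p b))))%:E * iter n L (sheet1 g) (pre a (p b)) else 0))%E.
    by apply: sume_ge0 => b; case: ifP.
  case: ifP => [|_]; last by rewrite mule_ge0// lee_fin.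
  rewrite in_setE => ay; have [b [b2 [bI _ [_ /= /andP[ab _]] _]]] := hI a.
  have apb : adj a (letter (base (p b)) 0) by rewrite pb.
  apply: (@le_trans _ _ ((E1 ^+ 2)%:E * ((phi (base (pre a (p b))))%:E *
      iter n L (sheet1 g) (pre a (p b))))%E); last first.
    rewrite lee_wpmul2l ?lee_fin//.
    rewrite (big_rem b bI)/= mem_set// leeDl//; apply: sume_ge0 => b' _.
    by case: ifP => // _; exact: term0.
  have a0 : letter (base (pre a y)) 0 = letter (base (pre a (p b))) 0.
    by rewrite !letter_pre0.
  have aa : agree 1 (pre a y) (pre a (p b)).
    split; last by case.
    rewrite /= py; congr (_ * _^-1)%g.
    by rewrite /cocycle !big_ord1; exact: psi_cyl.
  have h1 := phi_letter_dist a0.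
  have h2 := iter_transfer_distortion phi_gt0 psi_cyl r01 C_gt0 phi_dist (n := n)
    (@sheet1_ge0 R M G g) (@sheet1_ge0 R M G g) aa.
  rewrite expr1 in h2.
  have {}h2 : (iter n L (sheet1 g) (pre a y) <=
      E1%:E * iter n L (sheet1 g) (pre a (p b)))%E.
    by apply: h2 => y1 y2 y12; rewrite (sheet1_agree R g y12).
  have E10 : 0 <= E1 by exact: expR_ge0.
  rewrite -lee_fin in h1.
  apply: le_trans (lee_pmul _ _ h1 h2) _.
  - by rewrite lee_fin ltW.
  - by apply: iter_transfer_ge0 => // y'; exact: sheet1_ge0.
  by rewrite EFinM muleACA -EFinM -expr2.
rewrite esumZl//; last first.
  by move=> a _; apply: sume_ge0 => b _; case: ifP.
rewrite lee_wpmul2l ?lee_fin// esum_sum; last by move=> a b _ _; case: ifP.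
by apply: lee_sum => b _; rewrite -esum_mkcond transferE.
Qed.

(** Transitivity prescribes the group element at the moment when b appears, hence
    without the contribution of b, by which q is divided. *)
Lemma bridge_word (x : S) (q : G) (b : alphabet M) : exists (e : S) n,
  [/\ letter e 0 = letter x 0, letter e n = b & cocycle psi n.+1 e = q].
Proof.
have [pb pb0] := point_from b.
have [y [n [n1 [yf y0] yT]]] :=
  connecting psi_cyl transitive (mkX x 1%g) (mkX pb (q * (psi pb)^-1)%g) 0.
have eb : iter n (@theta M) (base y) = pb by rewrite -(base_iter psi) yT.
exists (base y), n; split; [exact: y0|by rewrite -pb0 -eb letter_iter addn0|].
have := fiber_iter psi n y; rewrite yT yf /= mul1g /cocycle big_ord_recr /= => <-.
by rewrite eb -mulgA mulVg mulg1.
Qed.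

Local Notation cyl1 a := (EFin \o \1_(ext_cyl [:: a] (1%g : G)) : X -> \bar R).

Lemma cyl1_ge0 a y : (0 <= cyl1 a y)%E.
Proof. by rewrite lee_fin. Qed.

(** One of the branches on the right prefixes y with a and the word of e. It
    starts in [a, id], and by distortion its weight is comparable to phi (a z)
    times the weight of the word. *)
Lemma bridge_lower (z : X) (q : G) (e : S) n a y :
  adj a (letter (base z) 0) -> letter e 0 = letter (base z) 0 ->
  cocycle psi n.+1 e = q -> adj (letter e n) (letter (base y) 0) ->
  ((phi (base (pre a z)))%:E * sheet1 (psi (base (pre a z)) * q)%g y <=
   (E1 ^+ 3 / Phi n.+1 e)%:E * iter n.+2 L (cyl1 a) y)%E.
Proof.
move=> az e0 eq ey.
have Phi0 := birkhoff_gt0 phi_gt0 n.+1 e.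
have rhs0 : (0 <= (E1 ^+ 3 / Phi n.+1 e)%:E * iter n.+2 L (cyl1 a) y)%E.
  apply: mule_ge0; last by apply: iter_transfer_ge0 => // ?; exact: cyl1_ge0.
  by rewrite lee_fin divr_ge0 ?exprn_ge0 ?expR_ge0 ?ltW.
rewrite sheet1E; case: eqP => [fy|_]; last by rewrite mule0.
rewrite mule1; have [w [we wy]] := splice ey.
have w0 : letter w 0 = letter (base z) 0 by rewrite we.
have aw : adj a (letter (base (mkX w (psi (base (pre a z))))) 0) by rewrite w0.
pose Y := pre a (mkX w (psi (base (pre a z)))).
have YT : iter n.+2 T Y = y.
  rewrite iterSr ext_map_pre//; apply: ext_eq; first by rewrite base_iter.
  rewrite fiber_iter fy /=; congr (_ * _)%g.
  by rewrite -eq; apply: cocycle_ext => // i; rewrite ltnS; exact: we.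
have YE : base Y = base (pre a (mkX w 1%g)) by [].
have Y0 : letter (base Y) 0 = letter (base (pre a z)) 0 by rewrite !letter_pre0.
have Yc : cyl1 a Y = 1%E.
  rewrite /= indicE mem_set//; split.
    by apply/cylP => -[|//] _ c; rewrite letter_pre0.
  rewrite /= /cocycle big_ord1 /=.
  by apply/eqP; rewrite mulg_eq1 invgK; apply/eqP; exact: psi_cyl (esym Y0).
rewrite -YT.
have := iter_transfer_lower psi phi_gt0 n.+2 Y (cyl1_ge0 a).
rewrite Yc mule1 => h; apply: (@le_trans _ _ ((E1 ^+ 3 / Phi n.+1 e)%:E * (Phi n.+2 (base Y))%:E)%E); last first.
  by rewrite lee_wpmul2l// lee_fin divr_ge0 ?exprn_ge0 ?expR_ge0 ?ltW.
have Yw : theta (base Y) = w by rewrite /Y theta_pre.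
rewrite -EFinM lee_fin [Phi n.+2 _]birkhoffS Yw.
have h1 := phi_letter_dist (esym Y0).
have h2 : Phi n.+1 e <= E1 ^+ 2 * Phi n.+1 w.
  by apply: birkhoff_letter_dist => i ilen; rewrite we.
rewrite mulrAC ler_pdivlMr//.
apply: le_trans (ler_pM _ _ h1 h2) _; [exact/ltW|exact/ltW|].
by rewrite le_eqVlt; apply/orP; left; apply/eqP; ring.
Qed.

(** The letter a next to z becomes the first letter of an orbit that starts on
    the identity sheet and ends at o. The list J enumerates, with a bound for the
    change of weight and the increase of length, the finitely many pairs of
    connecting words; it does not depend on n and a. *)
Lemma rotation (o z : X) (h : G) : exists J : seq (R * nat),
  (forall c, c \in J -> 0 <= c.1) /\
  forall n a, adj a (letter (base z) 0) ->
    ((phi (base (pre a z)))%:E * iter n.+1 L (sheet1 h) (pre a z) <=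
     \sum_(c <- J) (c.1)%:E * iter (n.+1 + c.2) L (cyl1 a) o)%E.
Proof.
have [I [I1 I2]] := transfer_switch.
have /choice[p /choice[m pm]] : forall b : alphabet M, exists p, exists m,
    [/\ letter (base p) 0 = b, fiber p = 1%g & iter m T p = o].
  move=> b; have [x xb] := point_from b.
  have [y [m [m1 [yf y0] yT]]] := connecting psi_cyl transitive (mkX x 1%g) o 0.
  by exists y, m; split; rewrite // y0.
have /choice[e /choice[l el]] := bridge_word (base z) ((fiber z)^-1 * h)%g.
pose K b := E1 ^+ 3 / Phi (l b).+1 (e b).
have K0 b : 0 <= K b.
  by rewrite divr_ge0 ?exprn_ge0 ?expR_ge0// ltW// birkhoff_gt0.
pose c2 b' b := E1 ^+ 2 * (K b * (Phi (m b') (base (p b')))^-1).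
have c20 b' b : 0 <= c2 b' b.
  rewrite mulr_ge0 ?exprn_ge0 ?expR_ge0// mulr_ge0// invr_ge0.
  exact/ltW/birkhoff_gt0.
exists [seq (c2 b' b, (m b' + (l b).+2)%N) | b' <- I, b <- I]; split.
  by move=> _ /allpairsP[[b' b] /= [_ _ ->]]; exact: c20.
move=> n a az.
rewrite big_allpairs_dep.
have -> : (\sum_(b' <- I) \sum_(b <- I)
    ((c2 b' b, (m b' + (l b).+2)%N).1)%:E *
      iter (n.+1 + (c2 b' b, (m b' + (l b).+2)%N).2) L (cyl1 a) o =
  \sum_(b' <- I) \sum_(b <- I)
    (c2 b' b)%:E * iter (n.+1 + (m b' + (l b).+2)) L (cyl1 a) o)%E by [].
(* the translation by k brings the branch a z to the identity sheet *)
set k := (psi (base (pre a z)) * (fiber z)^-1)%g.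
have -> : iter n.+1 L (sheet1 h) (pre a z) =
    iter n.+1 L (sheet1 (k * h)%g) (ltrans k (pre a z)).
  rewrite -iter_transfer_ltrans//; congr (iter _ _ _ _).
  apply/funext => y; rewrite !sheet1E /=; congr (if _ then _ else _).
  by apply/eqP/eqP => [->//|/mulgI].
have kf : fiber (ltrans k (pre a z)) = 1%g.
  rewrite /= /cocycle big_ord1 /= /k -[X in (_ * (_ * (psi X)^-1))%g]/(base (pre a z)).
  by rewrite -mulgA mulKg mulgV.
have kh : (k * h)%g = (psi (base (pre a z)) * ((fiber z)^-1 * h))%g.
  by rewrite /k mulgA.
have phi0 : (0 <= (phi (base (pre a z)))%:E)%E by rewrite lee_fin ltW.
apply: (@le_trans _ _ ((phi (base (pre a z)))%:E * ((E1 ^+ 2)%:E *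
    \sum_(b' <- I) iter n.+1 L (sheet1 (k * h)%g) (p b')))%E).
  rewrite lee_wpmul2l//; apply: I2 => b.
    by have [] := pm b.
  by rewrite kf; have [] := pm b.
rewrite muleCA ge0_sume_distrr; last first.
  by move=> b' _; apply: iter_transfer_ge0 => // ?; exact: sheet1_ge0.
rewrite ge0_sume_distrr; last first.
  move=> b' _; apply: mule_ge0 => //.
  by apply: iter_transfer_ge0 => // ?; exact: sheet1_ge0.
apply: lee_sum => b' _.
have Kit0 b y : (0 <= (K b)%:E * iter (l b).+2 L (cyl1 a) y)%E.
  by apply: mule_ge0; [rewrite lee_fin|apply: iter_transfer_ge0 => // ?; exact: cyl1_ge0].
apply: (@le_trans _ _ ((E1 ^+ 2)%:E * iter n.+1 L (fun y => \sum_(b <- I) ((K b)%:E * iter (l b).+2 L (cyl1 a) y)) (p b'))%E).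
  rewrite lee_wpmul2l ?lee_fin ?exprn_ge0 ?expR_ge0//.
  rewrite -iter_transferZ; [|exact: phi_gt0|exact: ltW|by move=> ?; exact: sheet1_ge0].
  apply: le_iter_transfer => // y.
  have [b bI by0] := I1 (letter (base y) 0).
  have [e0 eb ec] := el b.
  rewrite kh; apply: le_trans (bridge_lower az e0 ec _) _; first by rewrite eb.
  by rewrite (big_rem b bI)/= leeDl//; apply: sume_ge0 => b1 _; exact: Kit0.
rewrite iter_transfer_sum// ge0_sume_distrr; last first.
  by move=> b _; apply: iter_transfer_ge0.
apply: lee_sum => b _.
rewrite iter_transferZ//; last by move=> y; apply: iter_transfer_ge0 => // ?; exact: cyl1_ge0.
rewrite /c2 (EFinM (E1 ^+ 2)) (EFinM (K b)) -!muleA lee_wpmul2l ?lee_fin ?exprn_ge0 ?expR_ge0//.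
rewrite lee_wpmul2l ?lee_fin//.
have [_ _ <-] := pm b'.
rewrite lee_pdivlMl ?birkhoff_gt0// -iterD.
have := iter_transfer_lowerD psi phi_gt0 (m b') (n.+1 + (l b).+2) (p b') (cyl1_ge0 a).
by rewrite addnCA.
Qed.

End Rotation.

(** * Continuity and cylinders *)

Section Topology.
Context (R : realType) (M : markov_shift) (G : groupType).
Local Notation S := (shift_space M).
Local Notation X := (extension M G).
Implicit Types (x : S) (z : X) (f : X -> R).

Lemma letter_near x k : nbhs x [set x' | letter x' k = letter x k].
Proof.
have c : {for x, continuous (fun x' : S =>
    (letter x' k : discrete_topology (alphabet M)))}.
  apply: (@continuous_comp S _ _
    (set_val : S -> prod_topology (fun _ : nat => discrete_topology (alphabet M)))
    (fun u => proj k u)).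
    exact: initial_continuous.
  exact: proj_continuous.
exact: (c [set (letter x k : discrete_topology (alphabet M))] (discrete_set1 _)).
Qed.

(** Cylinders are neighbourhoods of their points, so a function with small
    oscillation on cylinders is continuous. *)
Lemma agree_near N z : nbhs z [set z' | agree N z z'].
Proof.
have hx : nbhs z.1 [set x' | forall i, (i < N)%N -> letter z.1 i = letter x' i].
  elim: N => [|N IH]; first exact: filterS filterT.
  apply: filterS (filterI IH (letter_near z.1 N)) => x' [h1 h2] i.
  by rewrite ltnS leq_eqVlt => /predU1P[->|/h1].
have hg : nbhs z.2 [set g' : discrete_group G | g' = z.2].
  exact: (discrete_set1 (z.2 : discrete_topology G)).
by exists ([set x' | forall i, (i < N)%N -> letter z.1 i = letter x' i],
  [set g' : discrete_group G | g' = z.2]) => //= -[x' g'] [/= ? ->]; split.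
Qed.

Lemma agree_continuous f :
  (forall z (e : R), 0 < e -> exists N, forall z', agree N z z' -> `|f z - f z'| < e) ->
  continuous f.
Proof.
move=> h z; apply/cvgrPdist_lt => e e0; have [N hN] := h z e e0.
by near=> z'; apply: hN; near: z'; exact: agree_near.
Unshelve. all: by end_near. Qed.

Lemma locally_constant_continuous f N :
  (forall z z', agree N z z' -> f z = f z') -> continuous f.
Proof.
move=> h; apply: agree_continuous => z e e0; exists N => z' zz'.
by rewrite (h _ _ zz') subrr normr0.
Qed.

Lemma borel_continuous_measurable f :
  continuous f -> measurable_fun setT (f : borel X -> R).
Proof.
move=> /continuousP cf; apply: (measurability _ (RGenOpens.measurableE R)).
move=> _ [_ [a [b ->] <-]]; rewrite setTI; apply: sub_sigma_algebra.
exact/cf/interval_open.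
Qed.

End Topology.

(** * The measures nu_z *)

Section Nu.
Context (R : realType) (M : markov_shift) (G : groupType).
Local Notation S := (shift_space M).
Local Notation X := (extension M G).
Context (phi : S -> R) (psi : S -> G) (r C : R).
Hypothesis phi_gt0 : forall x, 0 < phi x.
Hypothesis psi_cyl : forall x x' : S, letter x 0%N = letter x' 0%N -> psi x = psi x'.
Hypothesis r01 : 0 < r < 1.
Hypothesis C_gt0 : 0 < C.
Hypothesis phi_dist : forall n x x', (1 <= n)%N ->
    (forall i, (i < n)%N -> letter x i = letter x' i) ->
    phi x <= expR (C * r ^+ n) * phi x'.
Hypothesis transitive : ext_transitive psi.
Hypothesis shift_bip : bip M.
Context (xi : S) (lambda : nat -> R) (s : nat -> R).
Hypothesis weights : admissible_weights phi psi xi lambda.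
Hypothesis s_rho : decreases_to_rho phi psi xi s.
Context (nu : X -> {sigma_finite_measure set (borel X) -> \bar R}).
Hypothesis nu_spec : nu_family phi psi xi (weight lambda) s nu.
Implicit Types (x : S) (y z : X) (n k j : nat) (F H : X -> \bar R) (f g : X -> R).
Local Notation T := (ext_map psi).
Local Notation Phi := (birkhoff_prod phi).
Local Notation L := (ext_transfer phi psi).
Local Notation pre := (pre psi).
Local Notation b := (weight lambda).
Local Notation rho := (rho phi psi xi).
Local Notation E1 := (expR (dist_const r C * r)).
Local Notation poincare_at := (poincare_at phi psi xi lambda s).
Local Notation green := (green phi psi lambda).
Local Notation o := (mkX xi (1%g : G)).
Local Notation sheet1 := (@sheet1 R M G).

Let rho0 : 0 < rho.
Proof. exact: (rho_gt0 phi_gt0 psi_cyl r01 C_gt0 phi_dist transitive weights). Qed.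

Let s0 k : 0 < s k.
Proof. exact: (s_gt0 phi_gt0 psi_cyl r01 C_gt0 phi_dist transitive weights s_rho). Qed.

Let b0 n : 0 < b n. Proof. exact: (weight_gt0 weights). Qed.

Let bs0 n k : 0 < b n * s k ^- n.
Proof. by rewrite mulr_gt0// invr_gt0 exprn_gt0. Qed.

Let s_le k : s k <= s 0.
Proof. exact: (s_le0 s_rho). Qed.

(** The Green function normalized by the Poincare series, whose limit along k
    defines nu_z. *)
Definition ngreen k F z : \bar R := (((poincare_at k)^-1)%:E * green (s k) F z)%E.

Definition nuint f z : \bar R := (\int[nu z]_z' (f z')%:E)%E.

Local Arguments nuint f%_ring_scope z.

Lemma nuint_ge0 f z : (forall y, 0 <= f y) -> (0 <= nuint f z)%E.
Proof. by move=> f0; apply: integral_ge0 => y _; rewrite lee_fin. Qed.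

Lemma ngreen_cvg f z : continuous f -> (forall y, 0 <= f y) ->
  ngreen k (EFin \o f) z @[k --> \oo] --> nuint f z.
Proof. by move=> cf f0; have [+ _] := nu_spec; apply. Qed.

Lemma poincare_atV_ge0 k : 0 <= (poincare_at k)^-1.
Proof.
rewrite invr_ge0 fine_ge0//.
exact: (poincare_ge0 phi_gt0 psi_cyl r01 C_gt0 phi_dist transitive weights s_rho).
Qed.

Lemma poincare_atV_near (e : R) : 0 < e -> \forall k \near \oo, 0 < (poincare_at k)^-1 <= e.
Proof.
move=> e0; have := poincare_at_infty phi_gt0 psi_cyl r01 C_gt0 phi_dist transitive weights s_rho e^-1.
apply: filterS => k ek; have ? : 0 < poincare_at k by rewrite (lt_le_trans _ ek)// invr_gt0.
by rewrite invr_gt0 -[e]invrK lef_pV2 ?posrE ?invr_gt0 ?ek//; apply/andP.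
Qed.

Lemma ngreen_ge0 k F z : (forall y, 0 <= F y)%E -> (0 <= ngreen k F z)%E.
Proof.
by move=> F0; rewrite mule_ge0 ?lee_fin ?poincare_atV_ge0//; apply: (green_ge0 phi_gt0 weights).
Qed.

Lemma iter_transfer_fin f z : continuous f -> (forall y, 0 <= f y) ->
  (nuint f z < +oo)%E -> forall n, (1 <= n)%N -> (iter n L (EFin \o f) z < +oo)%E.
Proof.
move=> cf f0 mf n n1; have Ff0 y : (0 <= (EFin \o f) y)%E by rewrite lee_fin.
have := ngreen_cvg (z:=z) cf f0.
have mfin : nuint f z \is a fin_num by rewrite ge0_fin_numE// nuint_ge0.
rewrite -(fineK mfin) => /fine_cvgP[lfin _].
near \oo => k.
have lamfin : ngreen k (EFin \o f) z \is a fin_num by near: k.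
have /andP[p0 _] : 0 < (poincare_at k)^-1 <= 1 by near: k; exact: poincare_atV_near.
rewrite ltey; apply/eqP => itoo; move: lamfin; apply/negP.
suff -> : ngreen k (EFin \o f) z = +oo%E by [].
suff goo : green (s k) (EFin \o f) z = +oo%E by rewrite /ngreen goo gt0_muley ?lte_fin.
apply/eqP; rewrite -leye_eq.
apply: le_trans (nneseries_term_le (u := fun n => ((b n * s k ^- n)%:E *
  iter n L (EFin \o f) z)%E) _ n1); first by rewrite itoo gt0_muley ?lte_fin.
by move=> i; apply: (green_term_ge0 phi_gt0 weights).
Unshelve. all: by end_near. Qed.

(** Finitely many terms are negligible, since the Poincare series at s_k tends
    to infinity. *)
Lemma head_near F z N (e : R) : (forall y, 0 <= F y)%E -> 0 < e ->
  (forall n, (1 <= n)%N -> (iter n L F z < +oo)%E) ->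
  \forall k \near \oo, (((poincare_at k)^-1)%:E *
    \sum_(1 <= n < N) ((b n * s k ^- n)%:E * iter n L F z) <= e%:E)%E.
Proof.
move=> F0 e0 Ffin.
pose A := (\sum_(1 <= n < N) ((b n * rho ^- n)%:E * iter n L F z))%E.
have term0 n : (0 <= (b n * rho ^- n)%:E * iter n L F z)%E.
  by apply: (green_term_ge0 phi_gt0 weights).
have Afin : A \is a fin_num.
  rewrite ge0_fin_numE; last exact: sume_ge0.
  rewrite /A big_nat_cond; apply: lte_sum_pinfty => n /andP[/andP[n1 _] _].
  rewrite lte_mul_pinfty ?lee_fin ?Ffin//.
  by rewrite mulr_ge0 ?(ltW (b0 _))// invr_ge0 exprn_ge0// ltW.
have A0 : 0 <= fine A by rewrite fine_ge0// sume_ge0.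
have e1 : 0 < e / (fine A + 1) by rewrite divr_gt0// ltr_wpDl.
apply: filterS (poincare_atV_near e1) => k /andP[p0 pe].
apply: (@le_trans _ _ (((poincare_at k)^-1)%:E * A)%E).
  rewrite lee_wpmul2l ?lee_fin ?poincare_atV_ge0//.
  rewrite /A big_nat_cond [leRHS]big_nat_cond; apply: lee_sum => n /andP[/andP[_ nN] _].
  apply: lee_wpmul2r; first by apply: iter_transfer_ge0.
  rewrite lee_fin ler_wpM2l ?(ltW (b0 _))//.
  rewrite lef_pV2 ?posrE ?exprn_gt0// lerXn2r ?nnegrE ?ltW//.
  by have [] := s_rho.
rewrite -(fineK Afin) -EFinM lee_fin.
apply: (@le_trans _ _ (e / (fine A + 1) * fine A)); first exact: ler_wpM2r.
rewrite mulrAC ler_pdivrMr ?ltr_wpDl// mulrDr mulr1 lerDl ltW//.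
Qed.

(** By the previous lemma it is enough to compare large iterates. *)
Lemma nuint_le_eventually f g z1 z2 N : continuous f -> (forall y, 0 <= f y) ->
  continuous g -> (forall y, 0 <= g y) -> (nuint f z1 < +oo)%E ->
  (forall n, (N <= n)%N -> iter n L (EFin \o f) z1 <= iter n L (EFin \o g) z2)%E ->
  (nuint f z1 <= nuint g z2)%E.
Proof.
move=> cf f0 cg g0 mf fg; apply/lee_addgt0Pr => e e0.
have F0 y : (0 <= (EFin \o f) y)%E by rewrite lee_fin.
have H0 y : (0 <= (EFin \o g) y)%E by rewrite lee_fin.
have lg : (ngreen k (EFin \o g) z2 + e%:E)%E @[k --> \oo] --> (nuint g z2 + e%:E)%E.
  by apply: cvgeD; [exact: fin_num_adde_defl|exact: ngreen_cvg|exact: cvg_cst].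
apply: ereal_cvg_le (ngreen_cvg (z:=z1) cf f0) lg _.
have := head_near N.+1 F0 e0 (iter_transfer_fin cf f0 mf).
apply: filterS => k hk; rewrite addeC /ngreen /(green _ _ _).
rewrite (nneseries_split 1 N); last by move=> n _; apply: (green_term_ge0 phi_gt0 weights).
rewrite add1n ge0_muleDr; first last.
- by apply: nneseries_ge0 => n _ _; apply: (green_term_ge0 phi_gt0 weights).
- by apply: sume_ge0 => n _; apply: (green_term_ge0 phi_gt0 weights).
apply: leeD => //; rewrite lee_wpmul2l ?lee_fin ?poincare_atV_ge0//.
have tg0 n : (0 <= (b n * s k ^- n)%:E * iter n L (EFin \o g) z2)%E.
  by apply: (green_term_ge0 phi_gt0 weights).
rewrite [leRHS](nneseries_split 1 N)// add1n.
apply: (@le_trans _ _ (\sum_(N.+1 <= n <oo) ((b n * s k ^- n)%:E * iter n L (EFin \o g) z2))%E).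
  apply: lee_lim.
  - by apply: is_cvg_nneseries => n _ _; apply: (green_term_ge0 phi_gt0 weights).
  - by apply: is_cvg_nneseries.
  - apply: nearW => m; rewrite big_nat_cond [leRHS]big_nat_cond.
    apply: lee_sum => n /andP[/andP[Nn _] _].
    by rewrite lee_wpmul2l ?lee_fin ?(ltW (bs0 _ _))//; apply: fg; exact: ltnW.
by rewrite leeDr// sume_ge0.
Qed.

Lemma nuint_le_shift f g z1 z2 (c : R) m : continuous f -> (forall y, 0 <= f y) ->
  continuous g -> (forall y, 0 <= g y) -> 0 <= c ->
  (forall n, (1 <= n)%N ->
     iter n L (EFin \o f) z1 <= c%:E * iter (n + m) L (EFin \o g) z2)%E ->
  (nuint f z1 <= (c * s 0 ^+ m)%:E * nuint g z2)%E.
Proof.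
move=> cf f0 cg g0 c0 fg.
have F0 y : (0 <= (EFin \o f) y)%E by rewrite lee_fin.
have H0 y : (0 <= (EFin \o g) y)%E by rewrite lee_fin.
apply: (ereal_cvg_le (ngreen_cvg (z:=z1) cf f0) (v := fun k => ((c * s 0 ^+ m)%:E * ngreen k (EFin \o g) z2)%E)).
  by apply: cvgeZl => //; exact: ngreen_cvg.
apply: nearW => k; rewrite /ngreen muleCA lee_wpmul2l ?lee_fin ?poincare_atV_ge0//.
apply: (@le_trans _ _ (c%:E * \sum_(1 <= n <oo) ((b n * s k ^- n)%:E * iter (n + m) L (EFin \o g) z2))%E).
  have t0 n : (0 <= (b n * s k ^- n)%:E * iter (n + m) L (EFin \o g) z2)%E.
    by rewrite mule_ge0 ?lee_fin ?(ltW (bs0 _ _))//; apply: iter_transfer_ge0.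
  rewrite -nneseriesZl//.
  apply: lee_lim.
  - by apply: is_cvg_nneseries => n _ _; apply: (green_term_ge0 phi_gt0 weights).
  - by apply: is_cvg_nneseries => n _ _; rewrite mule_ge0.
  - apply: nearW => j; rewrite big_nat_cond [leRHS]big_nat_cond.
    apply: lee_sum => n /andP[/andP[n1 _] _].
    by rewrite muleCA lee_wpmul2l ?lee_fin ?(ltW (bs0 _ _))// fg.
rewrite EFinM -muleA lee_wpmul2l ?lee_fin//.
apply: (le_trans (green_shift phi_gt0 weights z2 m (s0 k) H0)).
apply: lee_wpmul2r; first by apply: (green_ge0 phi_gt0 weights).
by rewrite lee_fin lerXn2r ?nnegrE ?(ltW (s0 _))//.
Qed.


Lemma partial_transfer_le F z (D : set (alphabet M)) : (forall y, 0 <= F y)%E ->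
  D `<=` pred_letters z ->
  (\esum_(a in D) ((phi (base (pre a z)))%:E * F (pre a z)) <= L F z)%E.
Proof.
move=> F0 Dz; rewrite transferE; apply: ge_ereal_sup => _ [B [finB BD] <-].
by apply: ereal_sup_ubound; exists B => //; split => // a /BD/Dz.
Qed.

(** The contribution to the normalized Green function of L F at z of those
    backward orbits whose step next to z is a letter of D. *)
Definition last_step F (D : set (alphabet M)) k z : \bar R :=
  (((poincare_at k)^-1)%:E * \sum_(1 <= n <oo) ((b n * s k ^- n)%:E *
    \esum_(a in D) ((phi (base (pre a z)))%:E * iter n L F (pre a z))))%E.

Let esum_part0 F D n z : (forall y, 0 <= F y)%E ->
  (0 <= \esum_(a in D) ((phi (base (pre a z)))%:E * iter n L F (pre a z)))%E.
Proof. by move=> F0; apply: esum_ge0 => a _; apply: transfer_term_ge0 => // y; exact: iter_transfer_ge0. Qed.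

Let term_part0 F D n k z : (forall y, 0 <= F y)%E ->
  (0 <= (b n * s k ^- n)%:E *
    \esum_(a in D) ((phi (base (pre a z)))%:E * iter n L F (pre a z)))%E.
Proof. by move=> F0; rewrite mule_ge0 ?lee_fin ?(ltW (bs0 _ _))//; exact: esum_part0. Qed.

Lemma last_step_finite F D k z : (forall y, 0 <= F y)%E -> finite_set D ->
  last_step F D k z = (\esum_(a in D) ((phi (base (pre a z)))%:E * ngreen k F (pre a z)))%E.
Proof.
move=> F0 finD; rewrite esum_fset//; last first.
  by move=> a _; rewrite mule_ge0 ?lee_fin ?(ltW (phi_gt0 _))//; exact: ngreen_ge0.
rewrite fsbig_finite//= /last_step.
under eq_eseriesr => n _.
  rewrite esum_fset//; last first.
    by move=> a _; apply: transfer_term_ge0 => // y; exact: iter_transfer_ge0.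
  rewrite fsbig_finite//= ge0_sume_distrr; last first.
    by move=> a _; apply: transfer_term_ge0 => // y; exact: iter_transfer_ge0.
  over.
rewrite nneseries_sum; last first.
  move=> a n _; rewrite mule_ge0 ?lee_fin ?(ltW (bs0 _ _))//.
  by apply: transfer_term_ge0 => // y; exact: iter_transfer_ge0.
rewrite ge0_sume_distrr; last first.
  move=> a _; apply: nneseries_ge0 => n _ _.
  rewrite mule_ge0 ?lee_fin ?(ltW (bs0 _ _))//.
  by apply: transfer_term_ge0 => // y; exact: iter_transfer_ge0.
apply: eq_bigr => a _; rewrite /ngreen muleCA; congr (_ * _)%E.
rewrite -nneseriesZl; last by move=> n _; apply: (green_term_ge0 phi_gt0 weights).
by apply: eq_eseriesr => n _; rewrite muleCA.
Qed.

Lemma last_step_le F D k z : (forall y, 0 <= F y)%E -> D `<=` pred_letters z ->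
  (last_step F D k z <= (s k)%:E * ngreen k F z)%E.
Proof.
move=> F0 Dz; rewrite /last_step /ngreen muleCA lee_wpmul2l ?lee_fin ?poincare_atV_ge0//.
have := green_shift phi_gt0 weights z 1 (s0 k) F0.
rewrite expr1; apply: le_trans; apply: lee_nneseries => n _.
  by move=> _; exact: term_part0.
rewrite lee_wpmul2l ?lee_fin ?(ltW (bs0 _ _))// addn1 iterS.
by apply: partial_transfer_le => // y; exact: iter_transfer_ge0.
Qed.

Lemma esum_ngreen_cvg f (D : set (alphabet M)) z : finite_set D ->
  continuous f -> (forall y, 0 <= f y) ->
  (\esum_(a in D) ((phi (base (pre a z)))%:E * ngreen k (EFin \o f) (pre a z))
    @[k --> \oo] -->
   \esum_(a in D) ((phi (base (pre a z)))%:E * nuint f (pre a z)))%E.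
Proof.
move=> finD cf f0; rewrite esum_fset//; last first.
  by move=> a _; rewrite mule_ge0 ?lee_fin ?(ltW (phi_gt0 _))//; exact: nuint_ge0.
have t0 k a : (0 <= (phi (base (pre a z)))%:E * ngreen k (EFin \o f) (pre a z))%E.
  by rewrite mule_ge0 ?lee_fin ?(ltW (phi_gt0 _))//; apply: ngreen_ge0 => y; rewrite lee_fin.
under eq_fun => k do rewrite esum_fset// fsbig_finite//=.
rewrite fsbig_finite//=; apply: cvg_nnesum => a _; first by apply: nearW => k; exact: t0.
by apply: cvgeZl => //; exact: ngreen_cvg.
Qed.

(** Fatou's lemma: every finite part of the sum over the letters passes to the
    limit, and is bounded by the shifted Green function. *)
Lemma nuint_superharmonic f z : continuous f -> (forall y, 0 <= f y) ->
  (L (nuint f) z <= rho%:E * nuint f z)%E.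
Proof.
move=> cf f0; rewrite transferE; apply: ge_ereal_sup => _ [D [finD Dz] <-].
have F0 y : (0 <= (EFin \o f) y)%E by rewrite lee_fin.
rewrite -esum_fset//; last first.
  by move=> a _; rewrite mule_ge0 ?lee_fin ?(ltW (phi_gt0 _))//; exact: nuint_ge0.
have sl : ((s k)%:E * ngreen k (EFin \o f) z @[k --> \oo] --> rho%:E * nuint f z)%E.
  apply: cvgeM; [|by apply: cvg_EFin; [exact: nearW|have [] := s_rho]|exact: ngreen_cvg].
  have [mfin|mfin] := boolP (nuint f z \is a fin_num); first exact: mule_def_fin.
  by apply: mule_def_neq0_infty; rewrite // eqe gt_eqF.
apply: ereal_cvg_le (esum_ngreen_cvg finD cf f0) sl _.
by apply: nearW => k; rewrite -last_step_finite//; exact: last_step_le.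
Qed.


(** The ratio b_(n+1) / b_n is the factor lambda (n+1), which tends to 1. *)
Lemma weight_ratio (d : R) : 0 < d ->
  exists2 N, (1 <= N)%N & forall n, (N <= n)%N -> b n.+1 <= (1 + d) * b n.
Proof.
move=> d0; have [_ _ l1 _ _] := weights.
have : \forall n \near \oo, lambda n <= 1 + d.
  by apply: (cvgr_le _ l1); rewrite ltrDl.
move=> [N _ hN]; exists N.+1 => // n Nn.
rewrite weightS mulrC ler_wpM2r ?(ltW (b0 _))//.
by apply: hN => /=; apply: leq_trans (leqnSn _); exact: ltnW.
Qed.

(** Up to the finitely many n for which the ratio of consecutive weights is not
    close to 1, the Green function of F at z is the Green function of L F, and
    the factor s_k comes from the shift of the index. *)
Lemma ngreen_le_last_step F z (d e : R) : (forall y, 0 <= F y)%E -> 0 < d -> 0 < e ->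
  (forall n, (1 <= n)%N -> (iter n L F z < +oo)%E) ->
  \forall k \near \oo, ((s k)%:E * ngreen k F z <=
    e%:E + (1 + d)%:E * last_step F (pred_letters z) k z)%E.
Proof.
move=> F0 d0 e0 Ffin; have [N N1 hN] := weight_ratio d0.
have es0 : 0 < e / s 0 by rewrite divr_gt0.
apply: filterS (head_near N.+1 F0 es0 Ffin) => k hk.
have t0 n : (0 <= (b n * s k ^- n)%:E * iter n L F z)%E.
  by apply: (green_term_ge0 phi_gt0 weights).
rewrite /ngreen /(green _ _ _) (nneseries_split 1 N)// add1n ge0_muleDr; first last.
- by apply: nneseries_ge0.
- by apply: sume_ge0.
rewrite ge0_muleDr; first last.
- by rewrite mule_ge0 ?lee_fin ?poincare_atV_ge0//; apply: nneseries_ge0.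
- by rewrite mule_ge0 ?lee_fin ?poincare_atV_ge0//; apply: sume_ge0.
apply: leeD.
  apply: (@le_trans _ _ ((s 0)%:E * (e / s 0)%:E)%E); last first.
    by rewrite -EFinM mulrC divfK// gt_eqF.
  apply: lee_pmul => //; first by rewrite lee_fin ltW.
  - by rewrite mule_ge0 ?lee_fin ?poincare_atV_ge0//; apply: sume_ge0.
  - by rewrite lee_fin.
rewrite /last_step muleCA [leRHS]muleCA lee_wpmul2l ?lee_fin ?poincare_atV_ge0//.
have d1 : 0 <= 1 + d by rewrite addr_ge0// ltW.
rewrite -nneseriesZl// -[leRHS]nneseriesZl; last by move=> n _; exact: term_part0.
rewrite -nneseries_addn; last first.
  by move=> n; rewrite mule_ge0 ?lee_fin ?(ltW (s0 _)).
have v0 n : (0 <= (1 + d)%:E * ((b n * s k ^- n)%:E *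
    \esum_(a in pred_letters z) ((phi (base (pre a z)))%:E * iter n L F (pre a z))))%E.
  by rewrite mule_ge0 ?lee_fin//; exact: term_part0.
apply: (@le_trans _ _ (\sum_(N <= n <oo) ((1 + d)%:E * ((b n * s k ^- n)%:E *
    \esum_(a in pred_letters z) ((phi (base (pre a z)))%:E * iter n L F (pre a z)))))%E); last first.
  rewrite -(subnKC N1) [leRHS](nneseries_split 1 (N - 1))//.
  by rewrite leeDr// sume_ge0.
rewrite -[leRHS]nneseries_addn//; apply: lee_nneseries => n _.
  by move=> _; rewrite mule_ge0 ?lee_fin ?(ltW (s0 _)).
rewrite addnS iterS -transferE muleA -EFinM muleA -EFinM.
apply: lee_wpmul2r; first by apply: transfer_ge0 => // y; exact: iter_transfer_ge0.
rewrite lee_fin exprS invfM mulrCA (mulrA (s k)) divff ?gt_eqF// mul1r mulrA.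
by rewrite ler_wpM2r ?invr_ge0 ?exprn_ge0 ?(ltW (s0 _))// hN// leq_addl.
Qed.

Lemma last_step_split F (D : set (alphabet M)) k z : (forall y, 0 <= F y)%E ->
  (last_step F (pred_letters z) k z = last_step F (pred_letters z `&` D) k z +
    last_step F (pred_letters z `&` ~` D) k z)%E.
Proof.
move=> F0; rewrite /last_step -ge0_muleDr; first last.
- by apply: nneseries_ge0 => n _ _; exact: term_part0.
- by apply: nneseries_ge0 => n _ _; exact: term_part0.
congr (_ * _)%E; rewrite -nneseriesD; first last.
- by move=> n _ _; exact: term_part0.
- by move=> n _ _; exact: term_part0.
apply: eq_eseriesr => n _; rewrite -ge0_muleDr; [|exact: esum_part0..].
congr (_ * _)%E; apply: esumID => a _.
by apply: transfer_term_ge0 => // y; exact: iter_transfer_ge0.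
Qed.

(** Tightness in the first letter is expressed by these sets, which decrease to
    the empty set. *)
Definition far j : set X :=
  [set y | fiber y = 1%g /\ (j <= choice.pickle (letter (base y) 0))%N].

Lemma far_agree j y1 y2 : agree 1 y1 y2 ->
  (\1_(far j) y1 : R) = \1_(far j) y2.
Proof.
case=> f12 /(_ 0 isT) l12; rewrite !indicE; congr ((nat_of_bool _)%:R).
by apply/idP/idP; rewrite !in_setE /far /= f12 l12.
Qed.

Lemma far_continuous j : continuous (\1_(far j) : X -> R).
Proof. by apply: locally_constant_continuous => z z'; exact: far_agree. Qed.

Lemma sheet_continuous (h : G) : continuous (\1_(sheet h) : X -> R).
Proof.
apply: (@locally_constant_continuous _ _ _ _ 0) => z z' /(sheet1_agree R h).
by move=> [].
Qed.

Let indic0 (A : set X) y : 0 <= (\1_A y : R). Proof. by []. Qed.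

Lemma cyl1_sum_le j n (D : set (alphabet M)) y :
  D `<=` [set a | (j <= choice.pickle a)%N] ->
  (\esum_(a in D) iter n L (EFin \o \1_(ext_cyl [:: a] (1%g : G))) y <=
   iter n L (EFin \o \1_(far j)) y)%E.
Proof.
move=> Dj; apply: ge_ereal_sup => _ [B [finB BD] <-].
rewrite fsbig_finite//= -iter_transfer_sum//; last by move=> a z; exact: cyl1_ge0.
apply: le_iter_transfer => // z.
have c0 a : (0 <= (EFin \o \1_(ext_cyl [:: a] (1%g : G))) z :> \bar R)%E.
  exact: cyl1_ge0.
have cE a : z \in ext_cyl [:: a] (1%g : G) -> a = letter (base z) 0 /\ fiber z = 1%g.
  by rewrite in_setE => -[/cylP/(_ 0 isT a)/= -> ->].
have [zB|zB] := boolP (letter (base z) 0 \in fset_set B); last first.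
  rewrite big_seq big1 ?lee_fin// => a aB.
  rewrite /= indicE; case: (boolP (z \in _)) => [/cE[aE _]|//].
  by rewrite -aE aB in zB.
rewrite (bigD1_seq _ zB) ?fset_uniq//= big1 => [|a az]; last first.
  rewrite indicE; case: (boolP (z \in _)) => [/cE[aE _]|//].
  by rewrite aE eqxx in az.
rewrite adde0 lee_fin !indicE ler_nat.
case: (boolP (z \in ext_cyl _ _)) => // /cE[_ z1].
rewrite mem_set//; split => //; apply: Dj; apply: BD.
by move: zB; rewrite in_fset_set// in_setE.
Qed.

(** Rotation moves the step next to z to the beginning of an orbit that ends at
    o. The constant K depends neither on j nor on k. *)
Lemma last_step_tail_le (h : G) z : exists2 K, 0 <= K &
  forall j k, (last_step (sheet1 h) (pred_letters z `&` ~` [set a | (choice.pickle a < j)%N]) k z <=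
    K%:E * ngreen k (EFin \o \1_(far j)) o)%E.
Proof.
have [J [J0 hJ]] := rotation phi_gt0 psi_cyl r01 C_gt0 phi_dist transitive shift_bip o z h.
exists (\sum_(c <- J) c.1 * s 0 ^+ c.2).
  by rewrite big_seq sumr_ge0// => c /J0 c0; rewrite mulr_ge0// exprn_ge0// ltW.
move=> j k; set D := _ `&` _.
have F0 (y : X) : (0 <= (EFin \o \1_(far j)) y :> \bar R)%E by rewrite lee_fin.
rewrite /last_step /ngreen muleCA lee_wpmul2l ?lee_fin ?poincare_atV_ge0//.
have itd0 n l : (0 <= iter (n + l) L (EFin \o \1_(far j)) o)%E.
  exact: iter_transfer_ge0.
have tJ0 c n : c \in J -> (0 <= (c.1)%:E * ((b n * s k ^- n)%:E *
    iter (n + c.2) L (EFin \o \1_(far j)) o))%E.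
  by move=> cJ; rewrite !mule_ge0 ?lee_fin ?J0 ?(ltW (bs0 _ _)).
apply: (@le_trans _ _ (\sum_(1 <= n <oo) \sum_(c <- J | c \in J) ((c.1)%:E *
    ((b n * s k ^- n)%:E * iter (n + c.2) L (EFin \o \1_(far j)) o)))%E).
  apply: lee_lim.
  - by apply: is_cvg_nneseries => n _ _; apply: term_part0 => y; exact: sheet1_ge0.
  - apply: is_cvg_nneseries => n _ _.
    by apply: sume_ge0 => c cJ; exact: tJ0.
  apply: nearW => m; rewrite big_nat_cond [leRHS]big_nat_cond.
  apply: lee_sum => -[//|n] _; rewrite -big_seq.
  apply: (@le_trans _ _ ((b n.+1 * s k ^- n.+1)%:E *
    \sum_(c <- J) ((c.1)%:E * iter (n.+1 + c.2) L (EFin \o \1_(far j)) o))%E); last first.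
    rewrite [in leLHS]big_seq [leRHS]big_seq ge0_sume_distrr; last first.
      by move=> c cJ; rewrite mule_ge0 ?lee_fin ?J0.
    by apply: lee_sum => c _; rewrite muleCA.
  rewrite lee_wpmul2l ?lee_fin ?(ltW (bs0 _ _))//.
  apply: (@le_trans _ _ (\esum_(a in D) \sum_(c <- J | c \in J) ((c.1)%:E *
    iter (n.+1 + c.2) L (EFin \o \1_(ext_cyl [:: a] (1%g : G))) o))%E).
    by apply: le_esum => a [az _]; rewrite -big_seq; exact: hJ.
  have cy0 a c m' : c \in J -> (0 <= (c.1)%:E *
      iter m' L (EFin \o \1_(ext_cyl [:: a] (1%g : G))) o)%E.
    move=> cJ; rewrite mule_ge0 ?lee_fin ?J0//.
    by apply: iter_transfer_ge0 => // y; exact: cyl1_ge0.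
  rewrite esum_sum; last by move=> a c _ cJ; exact: cy0.
  rewrite [leRHS]big_seq; apply: lee_sum => c cJ.
  rewrite esumZl ?J0//; last first.
    by move=> a _; apply: iter_transfer_ge0 => // y; exact: cyl1_ge0.
  rewrite lee_wpmul2l ?lee_fin ?J0//; apply: cyl1_sum_le.
  by move=> a [_ /= /negP]; rewrite -leqNgt.
rewrite nneseries_sum; last by move=> c n cJ; exact: tJ0.
rewrite -big_seq big_seq.
rewrite -sumEFin big_seq ge0_sume_distrl; last first.
  by move=> c cJ; rewrite lee_fin mulr_ge0 ?J0// exprn_ge0// ltW.
apply: lee_sum => c cJ.
rewrite nneseriesZl; last first.
  by move=> n _; rewrite mule_ge0 ?lee_fin ?(ltW (bs0 _ _)).
rewrite EFinM -muleA lee_wpmul2l ?lee_fin ?J0//.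
apply: (le_trans (green_shift phi_gt0 weights _ _ (s0 k) F0)).
apply: lee_wpmul2r; first by apply: (green_ge0 phi_gt0 weights).
by rewrite lee_fin lerXn2r ?nnegrE ?(ltW (s0 _)).
Qed.



Lemma agree_measurable N (A : set X) :
  (forall z z', agree N z z' -> A z -> A z') -> measurable (A : set (borel X)).
Proof.
move=> h; apply: sub_sigma_algebra; rewrite openE => z Az.
by apply: filterS (agree_near N z) => z' /h; exact.
Qed.

Lemma nuintD f g z : continuous f -> continuous g ->
  (forall y, 0 <= f y) -> (forall y, 0 <= g y) ->
  nuint (f \+ g) z = (nuint f z + nuint g z)%E.
Proof.
move=> cf cg f0 g0.
have fg0 y : 0 <= (f \+ g) y by rewrite addr_ge0.
have cfg : continuous (f \+ g) by move=> y; apply: continuousD; [exact: cf|exact: cg].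
apply: (cvg_unique _ (ngreen_cvg (z:=z) cfg fg0)) => //.
have -> : (fun k => ngreen k (EFin \o (f \+ g)) z) =
    (fun k => ngreen k (EFin \o f) z + ngreen k (EFin \o g) z)%E.
  apply/funext => k; rewrite /ngreen -ge0_muleDr.
  - by rewrite -(greenD phi_gt0 weights)// => y; rewrite lee_fin.
  - by apply: (green_ge0 phi_gt0 weights) => // y; rewrite lee_fin.
  - by apply: (green_ge0 phi_gt0 weights) => // y; rewrite lee_fin.
apply: cvgeD; [|exact: ngreen_cvg|exact: ngreen_cvg].
by rewrite ge0_adde_def ?inE ?nuint_ge0.
Qed.

Lemma nuintZ (c : R) f z : 0 <= c -> continuous f -> (forall y, 0 <= f y) ->
  nuint (fun y => c * f y) z = (c%:E * nuint f z)%E.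
Proof.
move=> c0 cf f0.
have cf0 y : 0 <= c * f y by rewrite mulr_ge0.
have ccf : continuous (fun y => c * f y).
  by move=> y; apply: continuousM; [exact: cvg_cst|exact: cf].
apply: (cvg_unique _ (ngreen_cvg (z:=z) ccf cf0)) => //.
have -> : (fun k => ngreen k (EFin \o (fun y => c * f y)) z) =
    (fun k => c%:E * ngreen k (EFin \o f) z)%E.
  apply/funext => k; rewrite /ngreen [RHS]muleCA; congr (_ * _)%E.
  by rewrite -(greenZ phi_gt0 weights).
by apply: cvgeZl => //; exact: ngreen_cvg.
Qed.

Lemma nuint_le f g z : continuous f -> continuous g ->
  (forall y, 0 <= f y) -> (forall y, f y <= g y) -> (nuint f z <= nuint g z)%E.
Proof.
move=> cf cg f0 fg; have g0 y : 0 <= g y by exact: le_trans (fg y).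
apply: ereal_cvg_le (ngreen_cvg (z:=z) cf f0) (ngreen_cvg (z:=z) cg g0) _.
apply: nearW => k; rewrite lee_wpmul2l ?lee_fin ?poincare_atV_ge0//.
apply: (le_green phi_gt0 weights) => // n _.
by apply: le_iter_transfer => // y; rewrite lee_fin.
Qed.

(** The Green function of this indicator at o is the Poincare series itself. *)
Lemma nuint_sheet_origin : nuint (\1_(sheet (1%g : G))) o = 1%E.
Proof.
apply: (cvg_unique _ (ngreen_cvg (z:=o) (sheet_continuous (h:=1%g)) _)) => //.
apply: cvg_near_cst.
have := poincare_atV_near ltr01; apply: filterS => k /andP[p0 _].
rewrite /ngreen -/(sheet1 1%g) -poincareE -(poincare_atE phi_gt0 psi_cyl r01 C_gt0 phi_dist transitive weights s_rho).
by rewrite -EFinM mulVf// gt_eqF// -invr_gt0.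
Qed.

Lemma far0 : far 0 = sheet (1%g : G).
Proof. by apply/seteqP; split => [y []//|y y1]; split. Qed.

(** Rotation with j = 0, applied to the branch z of T z, bounds the mass of a
    sheet by a multiple of the mass of the identity sheet at o. *)
Lemma nuint_sheet_fin (h : G) z : (nuint (\1_(sheet h)) z < +oo)%E.
Proof.
have [K K0 hK] := last_step_tail_le h (T z).
have az : adj (letter (base z) 0) (letter (base (T z)) 0) by exact: letter_adj.
suff : ((phi (base z))%:E * nuint (\1_(sheet h)) z <= K%:E * nuint (\1_(far 0)) o)%E.
  move=> hle; rewrite ltey; apply/eqP => moo; move: hle.
  by rewrite moo far0 nuint_sheet_origin mule1 gt0_muley ?lte_fin.
have F0 y : (0 <= sheet1 h y)%E by exact: sheet1_ge0.
have c1 : ((phi (base z))%:E * ngreen k (sheet1 h) z @[k --> \oo] -->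
    (phi (base z))%:E * nuint (\1_(sheet h)) z)%E.
  apply: cvgeZl => //; apply: ngreen_cvg => //; exact: sheet_continuous.
have c2 : (K%:E * ngreen k (EFin \o \1_(far 0)) o @[k --> \oo] -->
    K%:E * nuint (\1_(far 0)) o)%E.
  apply: cvgeZl => //; apply: ngreen_cvg => //; exact: far_continuous.
apply: ereal_cvg_le c1 c2 _; apply: nearW => k; apply: le_trans (hK 0 k).
have -> : ((phi (base z))%:E * ngreen k (sheet1 h) z)%E =
    last_step (sheet1 h) [set letter (base z) 0] k (T z).
  rewrite last_step_finite// esum_set1 ?pre_ext_map//.
  by rewrite mule_ge0 ?lee_fin ?(ltW (phi_gt0 _))//; exact: ngreen_ge0.
rewrite /last_step lee_wpmul2l ?lee_fin ?poincare_atV_ge0//; apply: lee_nneseries => n _.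
  by move=> _; exact: term_part0.
rewrite lee_wpmul2l ?lee_fin ?(ltW (bs0 _ _))//.
rewrite [leRHS](esumID [set letter (base z) 0]); last first.
  by move=> a _; apply: transfer_term_ge0 => // y; exact: iter_transfer_ge0.
rewrite [X in (_ <= esum X _ + _)%E](_ : _ = [set letter (base z) 0]).
  by rewrite leeDl//; exact: esum_part0.
by apply/seteqP; split => [a []//|a ->]; split => //; split.
Qed.

(** Tightness: these sets decrease to the empty set and lie in a sheet of
    measure 1. *)
Lemma nuint_far_cvg : nuint (\1_(far j)) o @[j --> \oo] --> 0%E.
Proof.
have dE j : nuint (\1_(far j)) o = nu o (far j).
  rewrite /nuint integral_indic ?setIT//; apply: (@agree_measurable 1).
  by move=> z z' [f12 /(_ 0 isT) l12]; rewrite /far /= f12 l12.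
under eq_fun do rewrite dE.
rewrite -(measure0 (nu o)).
have -> : set0 = \bigcap_j (far j : set (borel X)).
  apply/esym/seteqP; split=> // y /(_ (choice.pickle (letter (base y) 0)).+1 I).
  by move=> [_]; rewrite ltnn.
apply: nonincreasing_cvg_mu => //.
- by have : (nu o (far 0) < +oo)%E by rewrite -dE far0 nuint_sheet_origin ltry.
- move=> j; apply: (@agree_measurable 1).
  by move=> z z' [f12 /(_ 0 isT) l12]; rewrite /far /= f12 l12.
- apply: bigcap_measurable => // j _; apply: (@agree_measurable 1).
  by move=> z z' [f12 /(_ 0 isT) l12]; rewrite /far /= f12 l12.
- move=> j k jk; apply/subsetPset => y [y1 yk]; split => //.
  exact: leq_trans yk.
Qed.

Lemma le_of_perturbed (u v : R) : 0 <= v ->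
  (forall d e, 0 < d -> 0 < e -> u <= e + (1 + d) * (v + e)) -> u <= v.
Proof.
move=> v0 h; rewrite leNgt; apply/negP => vu.
pose e := Num.min 1 ((u - v) / (2 * (v + 3))).
have v3 : 0 < 2 * (v + 3) by lra.
have e0 : 0 < e by rewrite lt_min ltr01 divr_gt0// subr_gt0.
have e1 : e <= 1 by rewrite ge_min lexx.
have e2 : e * (2 * (v + 3)) <= u - v.
  by rewrite -ler_pdivlMr// ge_min lexx orbT.
have := h e e e0 e0; nra.
Qed.

(** The last steps outside a finite set of letters contribute at most a multiple
    of the measure of a far set, which is as small as desired, uniformly in k; the
    sum over the remaining letters is finite and passes to the limit. *)
Lemma sheet_harmonic (h : G) z :
  (rho%:E * nuint (\1_(sheet h)) z <= L (nuint (\1_(sheet h))) z)%E.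
Proof.
set f : X -> R := \1_(sheet h).
have cf : continuous f by exact: sheet_continuous.
have f0 y : 0 <= f y by [].
have F0 y : (0 <= (EFin \o f) y)%E by rewrite lee_fin.
have mfin : nuint f z \is a fin_num by rewrite ge0_fin_numE ?nuint_ge0// nuint_sheet_fin.
have V0 : (0 <= L (nuint f) z)%E by apply: transfer_ge0 => // y; exact: nuint_ge0.
have Vfin : L (nuint f) z \is a fin_num.
  rewrite ge0_fin_numE//; apply: le_lt_trans (nuint_superharmonic _ cf f0) _.
  by rewrite -(fineK mfin) -EFinM ltry.
rewrite -(fineK mfin) -(fineK Vfin) -EFinM lee_fin.
apply: le_of_perturbed => [|d e d0 e0]; first exact: fine_ge0.
rewrite -lee_fin EFinM (fineK mfin) (EFinD e) (EFinM (1 + d)) (EFinD (fine _)) (fineK Vfin).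
have [K K0 hK] := last_step_tail_le h z.
have [j hj] : exists j, (K%:E * nuint (\1_(far j)) o <= e%:E)%E.
  have : (K%:E * nuint (\1_(far j)) o @[j --> \oo] --> 0)%E.
    by rewrite -(mule0 K%:E); apply: cvgeZl => //; exact: nuint_far_cvg.
  move=> /fine_cvgP[kfin /cvgr0_norm_le/(_ e e0) hk].
  near \oo => j; exists j; rewrite -[leLHS]fineK; last by near: j.
  by rewrite lee_fin (le_trans (ler_norm _))//; near: j.
(* finitely many letters are retained; the others belong to far j *)
pose D := pred_letters z `&` [set a | (choice.pickle a < j)%N].
have finD : finite_set D.
  apply: finite_setIr; apply: (@finite_preimage _ _ `I_j choice.pickle) => //.
  by move=> a b' _ _; exact: (pcan_inj choice.pickleK).
have sl : ((s k)%:E * ngreen k (EFin \o f) z @[k --> \oo] --> rho%:E * nuint f z)%E.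
  apply: cvgeM; [|by apply: cvg_EFin; [exact: nearW|have [] := s_rho]|exact: ngreen_cvg].
  exact: mule_def_fin.
have c0 : (0 <= (1 + d)%:E :> \bar R)%E by rewrite lee_fin addr_ge0// ltW.
have c1 : (e%:E + (1 + d)%:E * (\esum_(a in D) ((phi (base (pre a z)))%:E *
      ngreen k (EFin \o f) (pre a z)) + K%:E * ngreen k (EFin \o \1_(far j)) o)
    @[k --> \oo] -->
    e%:E + (1 + d)%:E * (\esum_(a in D) ((phi (base (pre a z)))%:E *
      nuint f (pre a z)) + K%:E * nuint (\1_(far j)) o))%E.
  apply: cvgeD => //; first exact: cvg_cst.
  apply: cvgeZl => //; apply: cvgeD; [|exact: esum_ngreen_cvg|].
    rewrite ge0_adde_def// inE; first by apply: esum_ge0 => a _; rewrite mule_ge0 ?lee_fin ?(ltW (phi_gt0 _))// nuint_ge0.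
    by rewrite mule_ge0 ?lee_fin// nuint_ge0.
  by apply: cvgeZl => //; apply: ngreen_cvg => //; exact: far_continuous.
apply: (@le_trans _ _ (e%:E + (1 + d)%:E * (\esum_(a in D) ((phi (base (pre a z)))%:E *
      nuint f (pre a z)) + K%:E * nuint (\1_(far j)) o))%E); last first.
  rewrite leeD2l// lee_wpmul2l//; apply: leeD => //.
  apply: partial_transfer_le => //; first by move=> y; exact: nuint_ge0.
  by move=> a [].
apply: ereal_cvg_le sl c1 _.
have := ngreen_le_last_step F0 d0 e0 (iter_transfer_fin cf f0 (nuint_sheet_fin h z)).
apply: filterS => k /le_trans; apply.
rewrite leeD2l// lee_wpmul2l// (last_step_split [set a | (choice.pickle a < j)%N])//.
by rewrite -last_step_finite// leeD//; exact: hK.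
Unshelve. all: by end_near. Qed.



Lemma harmonicD f g z : continuous f -> continuous g ->
  (forall y, 0 <= f y) -> (forall y, 0 <= g y) ->
  (rho%:E * nuint f z <= L (nuint f) z)%E -> (rho%:E * nuint g z <= L (nuint g) z)%E ->
  (rho%:E * nuint (f \+ g) z <= L (nuint (f \+ g)) z)%E.
Proof.
move=> cf cg f0 g0 hf hg.
have -> : nuint (f \+ g) = (fun y => nuint f y + nuint g y)%E.
  by apply/funext => y; rewrite nuintD.
rewrite transferD//; [|by move=> y; exact: nuint_ge0..].
by rewrite ge0_muleDr ?nuint_ge0// leeD.
Qed.

(** Both f and g are superharmonic, so equality for the sum forces equality for
    each. *)
Lemma harmonic_dominated f g z : continuous f -> continuous g ->
  (forall y, 0 <= f y) -> (forall y, 0 <= g y) -> (nuint (f \+ g) z < +oo)%E ->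
  (rho%:E * nuint (f \+ g) z <= L (nuint (f \+ g)) z)%E ->
  (rho%:E * nuint f z <= L (nuint f) z)%E.
Proof.
move=> cf cg f0 g0.
have -> : nuint (f \+ g) = (fun y => nuint f y + nuint g y)%E.
  by apply/funext => y; rewrite nuintD.
move=> fgfin; rewrite transferD//; [|by move=> y; exact: nuint_ge0..].
rewrite ge0_muleDr ?nuint_ge0// => h.
have gfin : (rho%:E * nuint g z)%E \is a fin_num.
  rewrite fin_numM// ge0_fin_numE ?nuint_ge0//; apply: le_lt_trans fgfin.
  by rewrite leeDr// nuint_ge0.
rewrite -(leeD2rE _ _ gfin); apply: (le_trans h).
by rewrite leeD2l//; exact: nuint_superharmonic.
Qed.

Lemma sheets_harmonic (c : R) (hs : seq G) z : 0 <= c ->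
  let f y := c * \sum_(h <- hs) (\1_(sheet h) y : R) in
  [/\ continuous f, forall y, 0 <= f y, (nuint f z < +oo)%E &
      (rho%:E * nuint f z <= L (nuint f) z)%E].
Proof.
move=> c0 /=.
suff [c1 h1 h2 h3] : let f y := \sum_(h <- hs) (\1_(sheet h) y : R) in
  [/\ continuous f, forall y, 0 <= f y, (nuint f z < +oo)%E &
      (rho%:E * nuint f z <= L (nuint f) z)%E].
  split.
  - by move=> y; apply: continuousM; [exact: cvg_cst|exact: c1].
  - by move=> y; rewrite mulr_ge0.
  - by rewrite nuintZ// lte_mul_pinfty// lee_fin.
  - rewrite nuintZ//.
    have -> : nuint (fun y => c * \sum_(h <- hs) (\1_(sheet h) y : R)) =
        (fun y => c%:E * nuint (fun y => \sum_(h <- hs) (\1_(sheet h) y : R))%R y)%E.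
      by apply/funext => y; rewrite nuintZ.
    rewrite transferZ//; last by move=> y; exact: nuint_ge0.
    by rewrite muleCA lee_wpmul2l.
elim: hs => [|h hs /= [c1 h1 h2 h3]] /=.
  have -> : (fun y : X => \sum_(h <- [::]) (\1_(sheet h) y : R)) = cst 0.
    by apply/funext => y; rewrite big_nil.
  have m0 : nuint (cst 0) z = 0%E by exact: integral0.
  split => //; first by move=> y; exact: cvg_cst.
  - by move=> y; rewrite big_nil.
  - by rewrite m0.
  rewrite m0 mule0; apply: transfer_ge0 => // y.
  by apply: nuint_ge0.
have -> : (fun y : X => \sum_(h <- h :: hs) (\1_(sheet h) y : R)) =
    (\1_(sheet h) \+ (fun y => \sum_(h <- hs) (\1_(sheet h) y : R))).
  by apply/funext => y; rewrite big_cons.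
have cs := sheet_continuous (h:=h).
split.
- by move=> y; apply: continuousD; [exact: cs|exact: c1].
- by move=> y; rewrite big_cons addr_ge0.
- by rewrite nuintD// lte_add_pinfty// nuint_sheet_fin.
- by apply: harmonicD => //; exact: sheet_harmonic.
Qed.

Hypothesis G_countable : countable [set: G].

(** Every f is the increasing limit of its truncations F j, which are bounded by j
    and supported in finitely many sheets. *)
Lemma nuint_harmonic_ge f z : continuous f -> (forall y, 0 <= f y) ->
  (rho%:E * nuint f z <= L (nuint f) z)%E.
Proof.
move=> cf f0; have /countable_injP[e einj] := G_countable.
pose A j : set X := [set y | (e (fiber y) < j)%N].
pose F j : X -> R := f \min (fun y => j%:R * \1_(A j) y).
have A_agree j y1 y2 : agree 0 y1 y2 -> (\1_(A j) y1 : R) = \1_(A j) y2.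
  case=> f12 _; rewrite !indicE; congr ((nat_of_bool _)%:R).
  by apply/idP/idP; rewrite !in_setE /A /= f12.
have cA j : continuous (fun y => j%:R * \1_(A j) y : R).
  apply: (@locally_constant_continuous _ _ _ _ 0) => y1 y2 y12.
  by rewrite (A_agree _ _ _ y12).
have A0 j y : 0 <= j%:R * \1_(A j) y :> R by rewrite mulr_ge0.
have cF j : continuous (F j).
  by move=> y; apply: continuous_min; [exact: cf|exact: cA].
have F0 j y : 0 <= F j y by rewrite /F /= le_min f0 A0.
have Ff j y : F j y <= f y by rewrite /F /= ge_min lexx.
have ndF y : nondecreasing_seq (fun j => (F j y)%:E).
  move=> i j ij; rewrite lee_fin /F /= le_min ge_min lexx/= ge_min.
  apply/orP; right; apply: ler_pM => //; first by rewrite ler_nat.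
  rewrite !indicE ler_nat; case: (boolP (y \in A i)) => //.
  rewrite in_setE /A /= => ei; rewrite mem_set//=.
  exact: leq_trans ij.
have cvgF y : (F j y)%:E @[j --> \oo] --> (f y)%:E.
  apply: cvg_near_cst; near=> j; congr EFin; apply/min_idPl.
  rewrite indicE mem_set ?mulr1; last by near: j; exact: nbhs_infty_gt.
  apply: le_trans (ltW (truncnS_gt _)) _.
  by rewrite ler_nat; near: j; exact: nbhs_infty_ge.
have : nuint (F j) z @[j --> \oo] --> nuint f z.
  have fE : (fun y : borel X => (f y)%:E) = (fun y => limn (fun j => (F j y)%:E)).
    by apply/funext => y; apply/esym/cvg_lim => //; exact: cvgF.
  rewrite /nuint fE; apply: (@cvg_monotone_convergence _ (borel X) R (nu z) setT) => //.
  - move=> j; apply/measurable_EFinP; apply: borel_continuous_measurable.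
    exact: cF.
  - by move=> j y _; rewrite lee_fin.
move=> /(cvgeZl (isT : rho%:E \is a fin_num)).
apply: cvge_le; apply: nearW => j.
apply: (@le_trans _ _ (L (nuint (F j)) z)); last first.
  apply: le_transfer => // y; exact: nuint_le.
have [hs hsE] : exists hs : seq G, [set g | (e g < j)%N] = [set` hs].
  apply/finite_seqP; apply: (@finite_preimage _ _ `I_j e) => //.
  by move=> g g' _ _; apply: einj; rewrite in_setE.
have [cw w0 wfin wh] := sheets_harmonic hs z (ler0n R j).
set w := (fun y : X => _) in cw w0 wfin wh.
have Fw y : F j y <= w y.
  rewrite /F /= ge_min; apply/orP; right; rewrite /w ler_wpM2l//.
  rewrite indicE; case: (boolP (y \in A j)) => [|_]; last by rewrite sumr_ge0.
  rewrite in_setE /A /= => ej.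
  have : [set` hs] (fiber y) by rewrite -hsE.
  move=> /= yhs; rewrite (big_rem _ yhs)/= indicE mem_set// lerDl sumr_ge0//.
(* F j lies below the combination w of sheets *)
pose v := w \- F j.
have wE : w = F j \+ v by apply/funext => y; rewrite /v /= addrC subrK.
have cv : continuous v by move=> y; apply: continuousB; [exact: cw|exact: cF].
have v0 y : 0 <= v y by rewrite subr_ge0.
by apply: (harmonic_dominated (cF j) cv) => //; rewrite -wE.
Unshelve. all: by end_near. Qed.

Lemma nuint_harmonic f z : continuous f -> (forall y, 0 <= f y) ->
  (L (nuint f) z = rho%:E * nuint f z)%E.
Proof.
move=> cf f0; apply/eqP; rewrite eq_le nuint_superharmonic//.
exact: nuint_harmonic_ge.
Qed.

(** The oscillation of f on long cylinders is small relative to its values; this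
    is the condition that C_n(f) tends to 0. *)
Definition regular f := forall e : R, 0 < e -> exists N, forall y1 y2,
  agree N y1 y2 -> `|f y1 - f y2| <= e * `|f y1|.

Lemma regular_continuous f : regular f -> continuous f.
Proof.
move=> rf; apply: agree_continuous => z e e0.
have e1 : 0 < e / (`|f z| + 1) by rewrite divr_gt0// ltr_wpDl.
have [N hN] := rf _ e1; exists N => z' /hN/le_lt_trans; apply.
by rewrite mulrAC ltr_pdivrMr ?ltr_wpDl// ltr_pM2l// ltrDl.
Qed.

(** An orbit from a small cylinder around z2 to z1 bounds the iterates at z2 by
    later iterates at z1. *)
Lemma nuint_finite f z1 z2 : regular f ->
  (nuint (fun y => `|f y|)%R z1 < +oo)%E -> (nuint (fun y => `|f y|)%R z2 < +oo)%E.
Proof.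
move=> rf mf; have [N hN] := rf 1 ltr01.
have [y [m [m1 yz yT]]] := connecting psi_cyl transitive z2 z1 N.
have cf : continuous (fun y => `|f y|)%R.
  by move=> z; apply: continuous_comp; [exact: regular_continuous|exact: norm_continuous].
have f2 y1 y2 : agree N.+1 y1 y2 -> `|f y1| <= 2 * `|f y2|.
  move=> /agree_sym /(agreeW (leqnSn N)) /hN; rewrite mul1r => h.
  have := ler_distD 0 (f y1) (f y2); rewrite sub0r subr0 normrN.
  have : `|f y1| <= `|f y1 - f y2| + `|f y2| by rewrite -{1}(subrK (f y2) (f y1)) ler_normD.
  rewrite distrC; lra.
pose E := expR (dist_const r C * r ^+ N.+1).
pose c := E * 2 / Phi m (base y).
have c0 : 0 <= c by rewrite divr_ge0 ?mulr_ge0 ?expR_ge0// ltW// birkhoff_gt0.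
suff : (nuint (fun y => `|f y|)%R z2 <= (c * s 0 ^+ m)%:E * nuint (fun y => `|f y|)%R z1)%E.
  move=> /le_lt_trans; apply; rewrite lte_mul_pinfty// lee_fin mulr_ge0//.
  by rewrite exprn_ge0// ltW.
apply: nuint_le_shift => // n n1.
have F0 (u : X) : (0 <= (EFin \o (fun y => `|f y|)%R) u)%E by rewrite lee_fin.
have F20 (u : X) : (0 <= 2%:E * (EFin \o (fun y => `|f y|)%R) u)%E by rewrite mule_ge0.
apply: le_trans (iter_transfer_distortion phi_gt0 psi_cyl r01 C_gt0 phi_dist F0 F20 (agree_sym yz) _) _.
  move=> y1 y2 /(agreeW (leq_addl n N.+1)) /f2.
  by rewrite /= -EFinM lee_fin.
have cE : c%:E = ((E * 2)%:E * ((Phi m (base y))^-1)%:E)%E by rewrite -EFinM.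
rewrite iter_transferZ// cE muleA -EFinM -muleA.
rewrite lee_wpmul2l ?lee_fin ?mulr_ge0 ?expR_ge0//.
rewrite lee_pdivlMl ?birkhoff_gt0// addnC -yT.
exact: iter_transfer_lowerD.
Qed.

(** The error e * g comes from the variation of f on long cylinders. It is
    arbitrarily small because small iterates do not matter, and only the
    distortion of the weights remains. *)
Lemma nuint_lipschitz f g z1 z2 j : continuous f -> (forall y, 0 <= f y) ->
  continuous g -> (forall y, 0 <= g y) ->
  (nuint f z1 < +oo)%E -> (nuint g z2 < +oo)%E ->
  (forall e : R, 0 < e -> exists N, forall y1 y2, agree N y1 y2 ->
    f y1 <= f y2 + e * g y2) ->
  agree j.+1 z1 z2 ->
  (nuint f z1 <= (expR (dist_const r C * r ^+ j.+1))%:E * nuint f z2)%E.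
Proof.
move=> cf f0 cg g0 mf mg fg z12; set E := expR _.
have E0 : 0 < E by exact: expR_gt0.
apply/lee_addgt0Pr => e e0.
have mgfin : nuint g z2 \is a fin_num by rewrite ge0_fin_numE ?nuint_ge0.
have mg0 : 0 <= fine (nuint g z2) by rewrite fine_ge0 ?nuint_ge0.
(* d is chosen so small that d * nu_z2(g) stays below e after multiplication by E *)
have [d d0 dE] : exists2 d, 0 < d & E * (d * fine (nuint g z2)) <= e.
  have A0 : 0 < E * (fine (nuint g z2) + 1) by rewrite mulr_gt0// ltr_wpDl.
  exists (e / (E * (fine (nuint g z2) + 1))); first by rewrite divr_gt0.
  rewrite -[leRHS](divfK (lt0r_neq0 A0)) mulrCA ler_wpM2l ?divr_ge0 ?(ltW e0) ?(ltW A0)//.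
  by rewrite ler_wpM2l ?lerDl// ltW.
have [N hN] := fg _ d0.
have cdg : continuous (fun y => d * g y).
  by move=> y; apply: continuousM; [exact: cvg_cst|exact: cg].
have dg0 y : 0 <= d * g y by rewrite mulr_ge0// ltW.
have cfg : continuous (f \+ (fun y => d * g y)).
  by move=> y; apply: continuousD; [exact: cf|exact: cdg].
have fg0 y : 0 <= (f \+ (fun y => d * g y)) y by rewrite addr_ge0.
apply: (@le_trans _ _ (nuint (fun y => E * (f \+ (fun y => d * g y)) y) z2)).
  apply: (nuint_le_eventually (N := N)) => //.
  - by move=> y; apply: (@continuousM _ _ (cst E) _ y _ (cfg y)); exact: cvg_cst.
  - by move=> y; rewrite mulr_ge0// ltW.
  move=> n Nn.
  have F0 (y : X) : (0 <= (EFin \o f) y)%E by rewrite lee_fin.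
  have H0 (y : X) : (0 <= (EFin \o (f \+ (fun y => d * g y))%R) y)%E by rewrite lee_fin.
  apply: le_trans (iter_transfer_distortion phi_gt0 psi_cyl r01 C_gt0 phi_dist F0 H0 z12 _) _.
    move=> y1 y2 /(agreeW (leq_trans Nn (leq_addr _ _))) /hN.
    by rewrite /= lee_fin.
  by rewrite -iter_transferZ// ltW.
rewrite nuintZ ?(ltW E0)// nuintD// nuintZ ?(ltW d0)//.
rewrite ge0_muleDr ?nuint_ge0//; last by rewrite mule_ge0 ?nuint_ge0// lee_fin ltW.
by rewrite leeD2l// -(fineK mgfin) -!EFinM lee_fin.
Qed.

Lemma expR_le_linear (B t : R) : 0 <= t <= B -> expR t <= 1 + t * expR B.
Proof.
move=> /andP[t0 tB]; have := expR_ge1Dx (- t); rewrite expRN => h.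
have e0 := expR_gt0 t.
have : (1 - t) * expR t <= 1 by rewrite -ler_pdivlMr// div1r.
have : expR t <= expR B by rewrite ler_expR.
nra.
Qed.

Definition lip_const := dist_const r C * expR (dist_const r C).

Lemma lip_const_gt0 : 0 < lip_const.
Proof. by rewrite mulr_gt0 ?expR_gt0//; exact: dist_const_gt0. Qed.

Lemma expR_dist_le j :
  expR (dist_const r C * r ^+ j) <= 1 + lip_const * r ^+ j.
Proof.
have D0 := dist_const_gt0 r01 C_gt0; have /andP[r0 r1] := r01.
apply: le_trans (expR_le_linear (B := dist_const r C) _) _.
  by rewrite mulr_ge0 ?exprn_ge0 ?(ltW D0) ?(ltW r0)//= ler_piMr ?exprn_ile1 ?(ltW D0) ?(ltW r0) ?(ltW r1).
by rewrite /lip_const mulrAC.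
Qed.

(** The factor 1 + lip_const accounts for exchanging z1 and z2 on the right. *)
Lemma nuint_diff_le f g z1 z2 j : continuous f -> (forall y, 0 <= f y) ->
  continuous g -> (forall y, 0 <= g y) ->
  (forall z, nuint f z < +oo)%E -> (forall z, nuint g z < +oo)%E ->
  (forall e : R, 0 < e -> exists N, forall y1 y2, agree N y1 y2 ->
    f y1 <= f y2 + e * g y2) ->
  agree j.+1 z1 z2 ->
  `|fine (nuint f z1) - fine (nuint f z2)| <=
    lip_const * (1 + lip_const) * r ^+ j.+1 * fine (nuint f z1).
Proof.
move=> cf f0 cg g0 mf mg fg z12.
have K0 := lip_const_gt0; have /andP[r0 r1] := r01.
have ffin z : nuint f z \is a fin_num by rewrite ge0_fin_numE ?nuint_ge0.
have u0 z : 0 <= fine (nuint f z) by rewrite fine_ge0 ?nuint_ge0.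
have lip y1 y2 : agree j.+1 y1 y2 ->
    fine (nuint f y1) <= (1 + lip_const * r ^+ j.+1) * fine (nuint f y2).
  move=> y12; have := nuint_lipschitz cf f0 cg g0 (mf y1) (mg y2) fg y12.
  rewrite -(fineK (ffin y1)) -(fineK (ffin y2)) -EFinM lee_fin => /le_trans; apply.
  by rewrite ler_wpM2r// expR_dist_le.
have h1 := lip _ _ z12; have h2 := lip _ _ (agree_sym z12).
have d0 : 0 <= r ^+ j.+1 by rewrite exprn_ge0// ltW.
have d1 : r ^+ j.+1 <= 1 by rewrite exprn_ile1// ltW.
move: h1 h2 (u0 z1) (u0 z2) => {lip}.
move: (fine (nuint f z1)) (fine (nuint f z2)) (r ^+ j.+1) d0 d1 => u v d d0 d1 h1 h2 u1 v1.
move: lip_const K0 h1 h2 => K K0 h1 h2; have K1 := ltW K0.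
rewrite ler_norml; apply/andP; split.
  have : v - u <= K * d * u by lra.
  have : 0 <= K * K * d * u by rewrite !mulr_ge0.
  lra.
have h3 : u - v <= K * d * v by lra.
have h4 : K * d * v <= K * d * ((1 + K * d) * u) by rewrite ler_wpM2l// mulr_ge0.
have h5 : K * d <= K by rewrite ler_piMr.
have h6 : 0 <= K * d * u by rewrite !mulr_ge0.
have := ler_wpM2l h6 h5; lra.
Qed.

End Nu.

(** * The shift metric *)

Section Distance.
Context (R : realType) (M : markov_shift) (G : groupType).
Local Notation S := (shift_space M).
Local Notation X := (extension M G).
Context (r : R).
Hypothesis r01 : 0 < r < 1.
Implicit Types (x y : S) (z : X).

Lemma first_diffE x y j : letter x j <> letter y j ->
  (forall i, (i < j)%N -> letter x i = letter y i) -> Defs.first_diff x y = j.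
Proof.
move=> xyj xyi; apply: xget_unique; first by split.
move=> k [xyk xyk']; have [kj|jk|//] := ltngtP k j.
  by have := xyk (xyi _ kj).
by have := xyj (xyk' _ jk).
Qed.

(** For j >= 1 this is equivalent to the distance of z1 and z2 being r^j. *)
Definition splits j z1 z2 :=
  agree j z1 z2 /\ letter (base z1) j <> letter (base z2) j.

Lemma splits_sym j z1 z2 : splits j z1 z2 -> splits j z2 z1.
Proof. by case=> /agree_sym h1 h2; split => // /esym. Qed.

Lemma shift_dist_splits j z1 z2 : splits j z1 z2 -> shift_dist r z1 z2 = r ^+ j.
Proof.
case=> -[f12 l12] d12; rewrite /shift_dist f12 eqxx.
case: eqP => [z12|_]; first by rewrite z12 in d12.
by rewrite (first_diffE d12 l12).
Qed.

Lemma close_splits z1 z2 : 0 < shift_dist r z1 z2 < 1 ->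
  exists j, splits j.+1 z1 z2.
Proof.
rewrite /shift_dist; case: eqP => [_|z12]; first by rewrite ltxx.
case: eqP => [f12|_]; last by rewrite ltxx andbF.
have [k kP] : exists k, letter (base z1) k != letter (base z2) k.
  apply: contrapT => /forallNP h; apply: z12; apply: ext_eq => //.
  by apply: shift_point_ext => k; have /negP/negPn/eqP := h k.
have := ex_intro (fun k => letter (base z1) k != letter (base z2) k) k kP.
move=> /ex_minnP[m /eqP mP mmin].
have ml i : (i < m)%N -> letter (base z1) i = letter (base z2) i.
  by move=> im; apply/eqP; apply/negPn/negP => /mmin; rewrite leqNgt im.
rewrite (first_diffE mP ml); case: m mP ml {mmin} => [|m] mP ml.
  by rewrite expr0 ltxx andbF.
by exists m.
Qed.

(** When c = 0 the hypothesis forces a = 0, and the convention 0/0 = 1 applies. *)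
Lemma quot_sub1_le (a c d e : R) : 0 <= a -> 0 <= c -> 0 < d -> 0 <= e ->
  `|a - c| <= e * d * c -> (`|quot a c - 1| * (d^-1)%:E <= e%:E)%E.
Proof.
move=> a0 c0 d0 e0 h; rewrite /quot; case: eqP => [c00|/eqP cn0].
  have -> : a == 0.
    by move: h; rewrite c00 subr0 mulr0 normr_le0.
  by rewrite subee// abse0 mul0e lee_fin.
have cp : 0 < c by rewrite lt_neqAle eq_sym cn0.
rewrite -EFinB abse_EFin -EFinM lee_fin ler_pdivrMr//.
have -> : a / c - 1 = (a - c) / c by rewrite mulrBl divff.
by rewrite normrM normfV (ger0_norm c0) ler_pdivrMr.
Qed.

End Distance.

(** * Positive elements of H *)

Section Harmonic.
Context (R : realType) (M : markov_shift) (G : groupType).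
Local Notation S := (shift_space M).
Local Notation X := (extension M G).
Context (phi : S -> R) (psi : S -> G) (r C : R).
Hypothesis phi_gt0 : forall x, 0 < phi x.
Hypothesis psi_cyl : forall x x' : S, letter x 0%N = letter x' 0%N -> psi x = psi x'.
Hypothesis r01 : 0 < r < 1.
Hypothesis C_gt0 : 0 < C.
Hypothesis phi_dist : forall n x x', (1 <= n)%N ->
    (forall i, (i < n)%N -> letter x i = letter x' i) ->
    phi x <= expR (C * r ^+ n) * phi x'.
Implicit Types (x : S) (y z : X) (n k j : nat).
Local Notation T := (ext_map psi).
Local Notation Phi := (birkhoff_prod phi).
Local Notation L := (ext_transfer phi psi).
Local Notation pre := (pre psi).
Local Notation K := (lip_const r C).

(** C_phi is finite: two branches of v agree in n letters more than the points. *)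
Lemma C_phi_le : (C_phi phi psi r <= K%:E)%E.
Proof.
apply: ge_ereal_sup => _ [n [v [z1 [z2 [n1 [vn _] [iv1 iv2] d12 ->]]]]].
rewrite lee_fin; have [j sj] := close_splits d12.
have K0 : 0 < K by exact: lip_const_gt0.
have /andP[r0 r1] := r01.
rewrite (shift_dist_splits r sj) ler_pdivrMr ?exprn_gt0//.
have [/cylP c1 t1] := tauP iv1; have [/cylP c2 t2] := tauP iv2.
have l12 i : (i < n + j.+1)%N ->
    letter (tau v (base z1)) i = letter (tau v (base z2)) i.
  move=> inj; have [iv|vi] := ltnP i (size v).
    by rewrite (c1 _ iv (letter (base z1) 0)) (c2 _ iv (letter (base z1) 0)).
  rewrite -(subnKC vi) -!letter_iter t1 t2.
  have [[_ ll] _] := sj; apply: ll.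
  by rewrite ltn_subLR// vn.
have h1 := birkhoff_distortion phi_gt0 r01 C_gt0 phi_dist (ltn0Sn j) l12.
have h2 := birkhoff_distortion phi_gt0 r01 C_gt0 phi_dist (ltn0Sn j)
  (fun i ij => esym (l12 i ij)).
have p1 := birkhoff_gt0 phi_gt0 n (tau v (base z1)).
have p2 := birkhoff_gt0 phi_gt0 n (tau v (base z2)).
have e1 := expR_dist_le r01 C_gt0 j.+1.
rewrite /= in h1 h2 p1 p2 *.
move: (Phi n (tau v (base z1))) (Phi n (tau v (base z2))) h1 h2 p1 p2 => a b h1 h2 p1 p2.
have d0 : 0 <= r ^+ j.+1 by rewrite exprn_ge0// ltW.
have g1 : a <= (1 + K * r ^+ j.+1) * b by apply: (le_trans h1); rewrite ler_wpM2r ?(ltW p2).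
have g2 : b <= (1 + K * r ^+ j.+1) * a by apply: (le_trans h2); rewrite ler_wpM2r ?(ltW p1).
have -> : a / b - 1 = (a - b) / b by rewrite mulrBl divff// gt_eqF.
rewrite normrM normfV (gtr0_norm p2) ler_pdivrMr// ler_norml; apply/andP; split; last by lra.
have [ab|ba] := leP b a.
  have := mulr_ge0 (mulr_ge0 (ltW K0) d0) (ltW p2).
  lra.
have := ler_wpM2l (mulr_ge0 (ltW K0) d0) (ltW ba).
lra.
Qed.

Lemma C_phi_birkhoff k j z1 z2 y1 y2 (c : R) : C_phi phi psi r = c%:E -> 0 <= c ->
  splits j.+1 z1 z2 -> iter k T y1 = z1 -> iter k T y2 = z2 ->
  agree k y1 y2 -> Phi k (base y1) <= (1 + c * r ^+ j.+1) * Phi k (base y2).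
Proof.
move=> cE c0 z12 y1z y2z [_ y12]; have /andP[r0 r1] := r01.
have d0 : 0 < r ^+ j.+1 by rewrite exprn_gt0.
case: k y1z y2z y12 => [|k] y1z y2z y12.
  by rewrite /birkhoff_prod !big_ord0 mulr1 lerDl mulr_ge0// ltW.
set v := mkseq (letter (base y1)) k.+1.
have vE : v = mkseq (letter (base y2)) k.+1.
  apply: (@eq_from_nth _ (letter (base y1) 0)); rewrite !size_mkseq// => i ik.
  by rewrite !nth_mkseq// y12.
have b1 : base z1 = iter k.+1 (@theta M) (base y1) by rewrite -y1z base_iter.
have b2 : base z2 = iter k.+1 (@theta M) (base y2) by rewrite -y2z base_iter.
have t1 : tau v (base z1) = base y1 by rewrite b1 tau_mkseq.
have t2 : tau v (base z2) = base y2 by rewrite b2 vE tau_mkseq.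
have p2 := birkhoff_gt0 phi_gt0 k.+1 (base y2).
have : (`|Phi k.+1 (base y1) / Phi k.+1 (base y2) - 1| / r ^+ j.+1 <= c).
  rewrite -lee_fin -cE; apply: ereal_sup_ubound.
  exists k.+1, v, z1, z2; split => //.
  - exact: words_mkseq.
  - split; [exists (base y1)|exists (base y2)].
    + exact/cyl_mkseq.
    + by rewrite size_mkseq.
    + by rewrite vE; exact/cyl_mkseq.
    + by rewrite size_mkseq.
  - by rewrite (shift_dist_splits r z12) d0 exprn_ilt1// ltW.
  - by rewrite /= (shift_dist_splits r z12) t1 t2.
rewrite ler_pdivrMr// => /(le_trans (ler_norm _)).
by rewrite lerBlDr ler_pdivrMr// [_ + 1]addrC.
Qed.

Lemma splits_pre j a z1 z2 : adj a (letter (base z1) 0) -> splits j.+1 z1 z2 ->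
  splits j.+2 (pre a z1) (pre a z2).
Proof.
move=> az [z12 d12]; split; first exact: agree_pre.
rewrite !letter_preS//; case: z12 => _ /(_ 0 isT) <- //.
Qed.

(** The induction on n lengthens the branches y1 and y2 of z1 and z2 one letter
    at a time, so that C_phi is only applied to the weights of complete branches
    and its factor appears once. *)
Lemma iter_transfer_C_phi (f h : X -> R) (c : R) j z1 z2 n k y1 y2 :
  C_phi phi psi r = c%:E -> 0 <= c ->
  (forall z, 0 <= f z) -> (forall z, 0 <= h z) ->
  (forall j z1 z2, splits j.+1 z1 z2 -> f z1 <= f z2 + r ^+ j.+1 * h z1) ->
  splits j.+1 z1 z2 -> iter k T y1 = z1 -> iter k T y2 = z2 ->
  splits (k + j.+1) y1 y2 ->
  ((Phi k (base y1))%:E * iter n L (EFin \o f) y1 <=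
   (1 + c * r ^+ j.+1)%:E * ((Phi k (base y2))%:E * iter n L (EFin \o f) y2) +
   (r ^+ (n + (k + j.+1)))%:E * ((Phi k (base y1))%:E * iter n L (EFin \o h) y1))%E.
Proof.
move=> cE c0 f0 h0 fh z12; have /andP[r0 r1] := r01.
have F0 (y : X) : (0 <= (EFin \o f) y)%E by rewrite lee_fin.
have H0 (y : X) : (0 <= (EFin \o h) y)%E by rewrite lee_fin.
have cd0 : 0 <= 1 + c * r ^+ j.+1 by rewrite addr_ge0// mulr_ge0// exprn_ge0// ltW.
elim: n k y1 y2 => [|n IH] k y1 y2 y1z y2z y12.
  have p1 := birkhoff_gt0 phi_gt0 k (base y1).
  have y12' : splits (k + j).+1 y1 y2 by rewrite -addnS.
  have hf := fh _ _ _ y12'.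
  have hP := C_phi_birkhoff cE c0 z12 y1z y2z (agreeW (leq_addr _ _) y12.1).
  rewrite /= -!EFinM -EFinD lee_fin add0n addnS.
  apply: (le_trans (ler_wpM2l (ltW p1) hf)).
  rewrite mulrDr; apply: lerD; last by rewrite mulrCA.
  by rewrite mulrA ler_wpM2r.
have y12' : splits (k + j).+1 y1 y2 by rewrite -addnS.
have it0 (u : X -> R) y : (forall z, 0 <= u z) -> (0 <= iter n L (EFin \o u) y)%E.
  by move=> u0; apply: iter_transfer_ge0 => // z; rewrite lee_fin.
have t0 a (u : X -> R) y : (forall z, 0 <= u z) ->
    (0 <= (phi (base (pre a y)))%:E * iter n L (EFin \o u) (pre a y))%E.
  by move=> u0; rewrite mule_ge0 ?it0// lee_fin ltW.
have pE : pred_letters y2 = pred_letters y1.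
  by have [[_ /(_ 0 isT) e] _] := y12'; rewrite /pred_letters e.
have P0 y : 0 <= Phi k (base y) by exact/ltW/birkhoff_gt0.
rewrite !iterS !transferE pE -!esumZl//; try by move=> *; exact: t0.
- rewrite -esumD.
  + apply: le_esum => a ay1.
    have ay2 : adj a (letter (base y2) 0).
      by have : pred_letters y2 a by rewrite pE.
    have PE y : adj a (letter (base y) 0) ->
        Phi k.+1 (base (pre a y)) = Phi k (base y) * phi (base (pre a y)).
      by move=> ay; rewrite birkhoffS theta_pre// mulrC.
    have := IH k.+1 (pre a y1) (pre a y2).
    rewrite !iterSr !ext_map_pre// => /(_ y1z y2z).
    rewrite addSn addnS => /(_ (splits_pre ay1 y12')).
    by rewrite !PE// !EFinM -!muleA !addnS addSn.
  + by move=> a _; rewrite mule_ge0// ?lee_fin// mule_ge0 ?lee_fin ?t0.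
  + move=> a _; rewrite mule_ge0 ?lee_fin ?exprn_ge0 ?(ltW r0)//.
    by rewrite mule_ge0 ?lee_fin ?t0.
- by rewrite exprn_ge0// ltW.
- by move=> a _; rewrite mule_ge0 ?lee_fin ?t0.
- by move=> a _; rewrite mule_ge0 ?lee_fin ?t0.
Qed.

Lemma eigenfunction_ge0 (c : R) (f : X -> R) : (forall z, 0 <= f z) ->
  eigenfunction phi psi c f <-> forall z, L (EFin \o f) z = (c * f z)%:E.
Proof.
move=> f0.
have fp : ((EFin \o f)^\+)%E = EFin \o f.
  by apply/funext => z; rewrite (@ge0_funeposE _ _ setT) ?in_setE// => y _; rewrite lee_fin.
have fn : ((EFin \o f)^\-)%E = cst 0%E.
  by apply/funext => z; rewrite (@ge0_funenegE _ _ setT) ?in_setE// => y _; rewrite lee_fin.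
have L0 z : L (cst 0%E) z = 0%E by rewrite transferE esum1// => a _; rewrite mule0.
split=> h z; first by have := h z; rewrite fp fn L0 sube0.
by rewrite fp fn L0 sube0.
Qed.

Lemma iter_eigen n (c : R) (f : X -> R) z : 0 <= c -> (forall z, 0 <= f z) ->
  (forall z, L (EFin \o f) z = (c * f z)%:E) ->
  iter n L (EFin \o f) z = (c ^+ n * f z)%:E.
Proof.
move=> c0 f0 fE; elim: n z => [|n IH] z; first by rewrite expr0 mul1r.
rewrite iterSr (_ : L (EFin \o f) = (fun y => c%:E * (EFin \o f) y)%E); last first.
  by apply/funext => y; rewrite fE EFinM.
rewrite iter_transferZ//.
by rewrite IH -EFinM mulrA exprS.
Qed.

Lemma D_at_le (f h : X -> R) j z1 z2 : (D_at r f z1 <= (h z1)%:E)%E ->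
  splits j.+1 z1 z2 -> `|f z1 - f z2| <= r ^+ j.+1 * h z1.
Proof.
move=> Df z12; have /andP[r0 r1] := r01.
have d0 : 0 < r ^+ j.+1 by rewrite exprn_gt0.
rewrite mulrC -ler_pdivrMr// -lee_fin; apply: le_trans Df.
apply: ereal_sup_ubound; exists z2; rewrite /= (shift_dist_splits r z12)//.
by rewrite d0 exprn_ilt1// ltW.
Qed.

(** The term with h decays like r^n and disappears from the estimate of f. *)
Lemma harmonic_LD (c : R) (f h : X -> R) : 0 < c ->
  (forall z, 0 <= f z) -> (forall z, 0 <= h z) ->
  (forall z, L (EFin \o f) z = (c * f z)%:E) ->
  (forall z, L (EFin \o h) z = (c * h z)%:E) ->
  (forall z, D_at r f z <= (h z)%:E)%E ->
  (LD r f <= C_phi phi psi r)%E.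
Proof.
move=> c0 f0 h0 fE hE Df; apply: ge_ereal_sup => _ [[z1 z2] /= d12 <-].
have /andP[r0 r1] := r01.
have [j z12] := close_splits d12.
have [e eE e0] : exists2 e : R, C_phi phi psi r = e%:E & 0 <= e.
  have [a aP] := adj_col (letter (base z1) 0).
  have C0 : (0 <= C_phi phi psi r)%E.
    apply: ereal_sup_ge; exists (`|birkhoff_prod phi 1 (base (ext_tau psi [:: a] z1)) /
      birkhoff_prod phi 1 (base (ext_tau psi [:: a] z2)) - 1| / shift_dist r z1 z2)%:E.
      exists 1%N, [:: a], z1, z2; split => //.
      split; apply/image_cyl1 => //.
      by case: z12 => -[_ /(_ 0 isT) <-].
    by rewrite lee_fin divr_ge0// ltW//; case/andP: d12.
  have Cfin : C_phi phi psi r \is a fin_num.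
    by rewrite ge0_fin_numE// (le_lt_trans C_phi_le)// ltry.
  by exists (fine (C_phi phi psi r)); [rewrite fineK|rewrite fine_ge0].
have d0 : 0 < r ^+ j.+1 by rewrite exprn_gt0.
have fh i y1 y2 : splits i.+1 y1 y2 -> f y1 <= f y2 + r ^+ i.+1 * h y1.
  move=> y12; rewrite -lerBlDl; apply: le_trans (ler_norm _) _.
  exact: D_at_le.
have key y1 y2 : splits j.+1 y1 y2 -> f y1 <= (1 + e * r ^+ j.+1) * f y2.
  move=> y12.
  have bound n : f y1 <= (1 + e * r ^+ j.+1) * f y2 + r ^+ (n + j.+1) * h y1.
    have := iter_transfer_C_phi n (k := 0) eE e0 f0 h0 fh y12 erefl erefl y12.
    rewrite /birkhoff_prod !big_ord0 !mul1e !(iter_eigen _ _ (ltW c0))//.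
    rewrite -!EFinM -EFinD lee_fin add0n => hn.
    have cn : 0 < c ^+ n by rewrite exprn_gt0.
    by rewrite -(ler_pM2l cn) mulrDr mulrCA [X in _ <= _ + X]mulrCA.
  have : (1 + e * r ^+ j.+1) * f y2 + r ^+ (n + j.+1) * h y1 @[n --> \oo] -->
      (1 + e * r ^+ j.+1) * f y2 + 0 * h y1.
    apply: cvgD; first exact: cvg_cst.
    apply: cvgMr_tmp; rewrite (cvg_shiftn j.+1 (fun n => r ^+ n)).
    by apply: cvg_expr; rewrite ger0_norm// ltW.
  rewrite mul0r addr0 => /cvgr_to_ge; apply.
  exact: nearW.
rewrite eE; apply: quot_sub1_le => //; first by case/andP: d12.
rewrite (shift_dist_splits r z12).
have h1 := key _ _ z12; have h2 := key _ _ (splits_sym z12).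
have ed0 : 0 <= e * r ^+ j.+1 by rewrite mulr_ge0// ltW.
rewrite ler_norml; apply/andP; split; last by lra.
have [ab|ba] := leP (f z2) (f z1).
  have := mulr_ge0 ed0 (f0 z2); lra.
have := ler_wpM2l ed0 (ltW ba); lra.
Qed.

End Harmonic.

(** * The map Theta *)

Lemma space_C_regular (R : realType) (M : markov_shift) (G : groupType)
    (mu : set (borel (extension M G)) -> \bar R) (f : extension M G -> R) :
  space_C mu f -> regular f.
Proof.
move=> [_ Cf] e e0.
have : \forall n \near \oo, (C_const n f < e%:E)%E.
  have /fine_cvgP[Cfin /cvgr_lt/(_ e e0) Ce] := Cf.
  by apply: filterS2 Cfin Ce => n nfin; rewrite -lte_fin fineK.
move=> [N _ hN]; exists N => y1 y2 [f12 l12].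
have := hN N (leqnn N) => /ereal_inf_lt[_ [c [c0 hc] <-]] /=.
rewrite lte_fin => ce.
apply: (@le_trans _ _ (c * `|f y1|)); last by rewrite ler_wpM2r// ltW.
apply: (hc (mkseq (letter (base y1)) N) (fiber y1)).
- exact: words_mkseq.
- by split => //; exact/cyl_mkseq.
- by split => //; apply/cyl_mkseq => i iN; rewrite l12.
Qed.

Section PositiveParts.
Context (R : realType) (M : markov_shift) (G : groupType).
Local Notation X := (extension M G).
Implicit Types f : X -> R.

Definition pos_part f : X -> R := fun y => Num.max (f y) 0.
Definition neg_part f : X -> R := fun y => Num.max (- f y) 0.

Lemma pos_part_ge0 f y : 0 <= pos_part f y.
Proof. by rewrite le_max lexx orbT. Qed.

Lemma neg_part_ge0 f y : 0 <= neg_part f y.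
Proof. by rewrite le_max lexx orbT. Qed.

Lemma parts_norm f y : `|f y| = pos_part f y + neg_part f y.
Proof.
rewrite /pos_part /neg_part; have [f0|] := boolP (0 <= f y).
  by rewrite ger0_norm// max_l// max_r ?addr0// oppr_le0.
rewrite -ltNge => f0; have nf0 : 0 <= - f y by rewrite oppr_ge0 ltW.
by rewrite ltr0_norm// (max_r (ltW f0)) (max_l nf0) add0r.
Qed.

Lemma pos_part_dist f y1 y2 : pos_part f y1 <= pos_part f y2 + `|f y1 - f y2|.
Proof.
have h := ler_norm (f y1 - f y2); have n0 := normr_ge0 (f y1 - f y2).
rewrite {1}/pos_part ge_max; apply/andP; split; last first.
  by rewrite addr_ge0// pos_part_ge0.
have : f y2 <= pos_part f y2 by rewrite le_max lexx.
lra.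
Qed.

Lemma neg_part_dist f y1 y2 : neg_part f y1 <= neg_part f y2 + `|f y1 - f y2|.
Proof.
have -> : neg_part f = pos_part (fun y => - f y) by [].
apply: le_trans (pos_part_dist _ y1 y2) _.
by rewrite lerD2l -opprD normrN.
Qed.

Lemma regular_pos_part f : regular f -> forall e : R, 0 < e -> exists N,
  forall y1 y2, agree N y1 y2 -> pos_part f y1 <= pos_part f y2 + e * `|f y2|.
Proof.
move=> rf e e0; have [N hN] := rf e e0; exists N => y1 y2 /agree_sym/hN h.
by apply: le_trans (pos_part_dist _ y1 y2) _; rewrite lerD2l distrC.
Qed.

Lemma regular_neg_part f : regular f -> forall e : R, 0 < e -> exists N,
  forall y1 y2, agree N y1 y2 -> neg_part f y1 <= neg_part f y2 + e * `|f y2|.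
Proof.
move=> rf e e0; have [N hN] := rf e e0; exists N => y1 y2 /agree_sym/hN h.
by apply: le_trans (neg_part_dist _ y1 y2) _; rewrite lerD2l distrC.
Qed.

Lemma regular_norm f : regular f -> forall e : R, 0 < e -> exists N,
  forall y1 y2, agree N y1 y2 -> `|f y1| <= `|f y2| + e * `|f y2|.
Proof.
move=> rf e e0; have [N hN] := rf e e0; exists N => y1 y2 /agree_sym/hN h.
by rewrite -lerBlDl; apply: le_trans (lerB_dist _ _) _; rewrite distrC.
Qed.

Lemma pos_part_continuous f : continuous f -> continuous (pos_part f).
Proof. by move=> cf y; apply: (@continuous_max _ _ f (cst 0)); [exact: cf|exact: cvg_cst]. Qed.

Lemma neg_part_continuous f : continuous f -> continuous (neg_part f).
Proof.
move=> cf y.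
apply: (@continuous_max _ _ (fun y => - f y) (cst 0)); last exact: cvg_cst.
by apply: continuousN; exact: cf.
Qed.

End PositiveParts.

Section Theta.
Context (R : realType) (M : markov_shift) (G : groupType).
Local Notation S := (shift_space M).
Local Notation X := (extension M G).
Context (phi : S -> R) (psi : S -> G) (r C : R).
Hypothesis phi_gt0 : forall x, 0 < phi x.
Hypothesis psi_cyl : forall x x' : S, letter x 0%N = letter x' 0%N -> psi x = psi x'.
Hypothesis r01 : 0 < r < 1.
Hypothesis C_gt0 : 0 < C.
Hypothesis phi_dist : forall n x x', (1 <= n)%N ->
    (forall i, (i < n)%N -> letter x i = letter x' i) ->
    phi x <= expR (C * r ^+ n) * phi x'.
Hypothesis transitive : ext_transitive psi.
Hypothesis shift_bip : bip M.
Hypothesis G_countable : countable [set: G].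
Context (xi : S) (lambda : nat -> R) (s : nat -> R).
Hypothesis weights : admissible_weights phi psi xi lambda.
Hypothesis s_rho : decreases_to_rho phi psi xi s.
Context (nu : X -> {sigma_finite_measure set (borel X) -> \bar R}).
Hypothesis nu_spec : nu_family phi psi xi (weight lambda) s nu.
Implicit Types (x : S) (y z : X) (n k j : nat).
Local Notation L := (ext_transfer phi psi).
Local Notation rho := (rho phi psi xi).
Local Notation nuint := (nuint nu).
Local Notation K := (lip_const r C).

Variable f : X -> R.
Hypothesis rf : regular f.
Hypothesis f_fin : forall z, (nuint (fun y => `|f y|)%R z < +oo)%E.

Let cf : continuous f. Proof. exact: regular_continuous. Qed.

Let cn : continuous (fun y => `|f y|).
Proof. by move=> z; apply: continuous_comp; [exact: cf|exact: norm_continuous]. Qed.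

Let cp : continuous (pos_part f). Proof. exact: pos_part_continuous. Qed.
Let cm : continuous (neg_part f). Proof. exact: neg_part_continuous. Qed.

Let nuint_norm z : nuint (fun y => `|f y|)%R z =
  (nuint (pos_part f) z + nuint (neg_part f) z)%E.
Proof.
rewrite -(nuintD phi_gt0 psi_cyl r01 C_gt0 phi_dist transitive weights s_rho nu_spec)//;
  [|exact: pos_part_ge0|exact: neg_part_ge0].
by congr (nuint _ z); apply/funext => y; exact: parts_norm.
Qed.

Let p0 z : (0 <= nuint (pos_part f) z)%E.
Proof. by apply: nuint_ge0 => y; exact: pos_part_ge0. Qed.

Let m0 z : (0 <= nuint (neg_part f) z)%E.
Proof. by apply: nuint_ge0 => y; exact: neg_part_ge0. Qed.

Let pfin z : nuint (pos_part f) z \is a fin_num.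
Proof.
rewrite ge0_fin_numE//; apply: le_lt_trans (f_fin z).
by rewrite nuint_norm leeDl.
Qed.

Let mfin z : nuint (neg_part f) z \is a fin_num.
Proof.
rewrite ge0_fin_numE//; apply: le_lt_trans (f_fin z).
by rewrite nuint_norm leeDr.
Qed.

Lemma ThetaE z : Theta nu f z =
  fine (nuint (pos_part f) z) - fine (nuint (neg_part f) z).
Proof.
rewrite /Theta /Rintegral integralE -[RHS]fineB//.
congr (fine (_ - _)%E); apply: eq_integral => y _.
  by rewrite funeposE -EFin_max.
by rewrite funenegE -EFinN -EFin_max.
Qed.

Lemma Theta_integrable z : (nu z).-integrable setT (EFin \o f).
Proof.
apply/integrableP; split.
  by apply/measurable_EFinP; exact: borel_continuous_measurable.
exact: f_fin.
Qed.

(** The positive and negative parts of f give two harmonic functions, but not the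
    positive and negative parts of Theta f. The two pairs have the same
    difference, and all sums over branches are finite. *)
Lemma Theta_eigen : eigenfunction phi psi rho (Theta nu f).
Proof.
move=> z; set Th := EFin \o Theta nu f.
have hp := nuint_harmonic phi_gt0 psi_cyl r01 C_gt0 phi_dist transitive shift_bip
  weights s_rho nu_spec G_countable z cp (@pos_part_ge0 R M G f).
have hm := nuint_harmonic phi_gt0 psi_cyl r01 C_gt0 phi_dist transitive shift_bip
  weights s_rho nu_spec G_countable z cm (@neg_part_ge0 R M G f).
have ThE y : (Th y = nuint (pos_part f) y - nuint (neg_part f) y)%E.
  by rewrite /Th /= ThetaE EFinB !fineK.
have T0 y : (0 <= Th^\+ y)%E by rewrite funeposE le_max lexx orbT.
have T0' y : (0 <= Th^\- y)%E by rewrite funenegE le_max lexx orbT.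
have swap y : (Th^\+ y + nuint (neg_part f) y = Th^\- y + nuint (pos_part f) y)%E.
  rewrite funeposE funenegE ThE; move: (pfin y) (mfin y).
  case: (nuint (pos_part f) y) => // a _; case: (nuint (neg_part f) y) => // c _.
  rewrite -EFinB -EFinN -!EFin_max -!EFinD; congr EFin.
  have [ac|] := boolP (0 <= a - c).
    by rewrite max_l// max_r ?oppr_le0//; ring.
  rewrite -ltNge => ac; have nac : 0 <= - (a - c) by rewrite oppr_ge0 ltW.
  by rewrite (max_r (ltW ac)) (max_l nac); ring.
have sumE : (L Th^\+ z + L (nuint (neg_part f)) z =
    L Th^\- z + L (nuint (pos_part f)) z)%E.
  rewrite -!transferD//; congr (L _ z); apply/funext => y; exact: swap.
have lp : (L Th^\+ z <= L (nuint (pos_part f)) z)%E.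
  apply: le_transfer => // y; rewrite funeposE ge_max p0 andbT ThE.
  by rewrite leeBlDr// leeDl.
have lm : (L Th^\- z <= L (nuint (neg_part f)) z)%E.
  apply: le_transfer => // y; rewrite funenegE ge_max m0 andbT ThE.
  move: (pfin y) (mfin y) (p0 y).
  case: (nuint (pos_part f) y) => // a _; case: (nuint (neg_part f) y) => // c _.
  by rewrite -EFinB -EFinN !lee_fin => a0; lra.
have Lpfin : L (nuint (pos_part f)) z \is a fin_num by rewrite hp fin_numM.
have Lmfin : L (nuint (neg_part f)) z \is a fin_num by rewrite hm fin_numM.
have LTp : (L Th^\+ z)%E \is a fin_num.
  rewrite ge0_fin_numE; last exact: transfer_ge0.
  by apply: le_lt_trans lp _; rewrite ltey_eq Lpfin.
have LTm : (L Th^\- z)%E \is a fin_num.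
  rewrite ge0_fin_numE; last exact: transfer_ge0.
  by apply: le_lt_trans lm _; rewrite ltey_eq Lmfin.
rewrite ThetaE mulrBr EFinB !EFinM (fineK (pfin z)) (fineK (mfin z)) -hp -hm.
move: sumE.
rewrite -(fineK LTp) -(fineK LTm) -(fineK Lpfin) -(fineK Lmfin).
rewrite -!EFinD => -[] h; congr EFin; lra.
Qed.

(** The dominating element of H^+ is a multiple of nu_z(|f|); the multiple is the
    Lipschitz constant of nuint_diff_le. *)
Lemma Theta_H : H_space phi psi xi r (Theta nu f).
Proof.
split; first exact: Theta_eigen.
have K0 := lip_const_gt0 r01 C_gt0; have /andP[r0 r1] := r01.
pose K' := K * (1 + K).
have K'0 : 0 < K' by rewrite mulr_gt0// addr_gt0.
have n0 z : 0 <= fine (nuint (fun y => `|f y|)%R z) by rewrite fine_ge0// nuint_ge0.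
have nE z : fine (nuint (fun y => `|f y|)%R z) =
    fine (nuint (pos_part f) z) + fine (nuint (neg_part f) z).
  by rewrite nuint_norm fineD.
have nfin z : nuint (fun y => `|f y|) z \is a fin_num.
  by rewrite ge0_fin_numE// nuint_ge0.
have pf z : (nuint (pos_part f) z < +oo)%E by rewrite ltey_eq pfin.
have mf z : (nuint (neg_part f) z < +oo)%E by rewrite ltey_eq mfin.
have diff := nuint_diff_le phi_gt0 psi_cyl r01 C_gt0 phi_dist transitive
  weights s_rho nu_spec.
exists (fun z => K' * fine (nuint (fun y => `|f y|)%R z)).
- split.
  + by move=> z; rewrite mulr_ge0// ltW.
  + apply/eigenfunction_ge0 => [z|z]; first by rewrite mulr_ge0// ltW.
    rewrite (_ : EFin \o _ = (fun y => K'%:E * nuint (fun y => `|f y|)%R y)%E); last first.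
      by apply/funext => y; rewrite /= EFinM fineK// ge0_fin_numE// nuint_ge0.
    rewrite transferZ ?(ltW K'0)//; last by move=> y; exact: nuint_ge0.
    rewrite (nuint_harmonic phi_gt0 psi_cyl r01 C_gt0 phi_dist transitive shift_bip
      weights s_rho nu_spec G_countable)//.
    by rewrite mulrCA (EFinM K') (EFinM rho) (fineK (nfin z)).
  + apply: (@le_lt_trans _ _ K'%:E); last exact: ltry.
    apply: ge_ereal_sup => _ [[z1 z2] /= d12 <-].
    have [j z12] := close_splits d12.
    have h0 z : 0 <= K' * fine (nuint (fun y => `|f y|)%R z) by rewrite mulr_ge0// ltW.
    apply: quot_sub1_le => //; [by case/andP: d12|exact: ltW|].
    rewrite (shift_dist_splits r z12) -mulrBr normrM (gtr0_norm K'0) mulrCA ler_wpM2l ?(ltW K'0)//.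
    rewrite distrC; exact: (diff _ _ _ _ _ cn (fun=> normr_ge0 _) cn
      (fun=> normr_ge0 _) f_fin f_fin (regular_norm rf) (agree_sym z12.1)).
- move=> z1; apply: ge_ereal_sup => _ [z2 d12 <-].
  have [j z12] := close_splits d12.
  rewrite lee_fin (shift_dist_splits r z12) ler_pdivrMr ?exprn_gt0//.
  rewrite !ThetaE nE.
  have hp := diff _ _ _ _ _ cp (@pos_part_ge0 R M G f) cn (fun=> normr_ge0 _)
    pf f_fin (regular_pos_part rf) z12.1.
  have hm := diff _ _ _ _ _ cm (@neg_part_ge0 R M G f) cn (fun=> normr_ge0 _)
    mf f_fin (regular_neg_part rf) z12.1.
  set p1 := fine (nuint (pos_part f) z1); set p2 := fine (nuint (pos_part f) z2).
  set m1 := fine (nuint (neg_part f) z1); set m2 := fine (nuint (neg_part f) z2).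
  have -> : p1 - m1 - (p2 - m2) = (p1 - p2) - (m1 - m2) by ring.
  apply: le_trans (ler_normB _ _) _.
  rewrite -/K' in hp hm.
  apply: (le_trans (lerD hp hm)).
  by rewrite -mulrDr mulrAC.
Qed.

End Theta.

Unset Implicit Arguments.

Theorem theorem6p1 (R : realType) (M : markov_shift) (G : groupType)
    (phi : shift_space M -> R) (psi : shift_space M -> G) (r : R)
    (m0 : probability (borel (shift_space M)) R)
    (xi : shift_space M) (lambda : nat -> R) (s : nat -> R)
    (nu : extension M G ->
          {sigma_finite_measure set (borel (extension M G)) -> \bar R})
    (xi0 : extension M G)
    (G_countable : countable [set: G])
    (phi_gt0 : forall x, 0 < phi x)
    (pressure0 : forall a : alphabet M, gurevich_pressure phi a = 0%E)
    (shift_bip : bip M)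
    (r01 : 0 < r < 1)
    (phi_hoelder : locally_hoelder r (fun x => ln (phi x)))
    (m0_invariant : transfer_invariant phi m0)
    (m0_gibbs_markov : gibbs_markov m0)
    (psi_cyl : forall x y, letter x 0%N = letter y 0%N -> psi x = psi y)
    (transitive : ext_transitive psi)
    (weights : admissible_weights phi psi xi lambda)
    (propC : property_C phi psi xi (weight lambda))
    (s_rho : decreases_to_rho phi psi xi s)
    (nu_spec : nu_family phi psi xi (weight lambda) s nu)
    (xi0_id : sheet 1%g xi0) :
  (forall f, space_C (nu xi0) f ->
     (forall z, (nu z).-integrable setT (EFin \o f)) /\
     H_space phi psi xi r (Theta nu f)) /\
  (forall f, H_space phi psi xi r f -> (forall z, 0 <= f z) ->
     (LD r f <= C_phi phi psi r)%E /\ H_plus phi psi xi r f).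
Proof.
have [C C0 phi_dist] := hoelder_distortion phi_gt0 phi_hoelder.
split=> [f Cf|f [f_eigen [h [h0 h_eigen _] Df]] f0].
  have rf := space_C_regular Cf.
  have f_fin z : (nuint nu (fun y => `|f y|)%R z < +oo)%E.
    by apply: (nuint_finite phi_gt0 psi_cyl r01 C0 phi_dist transitive
      weights s_rho nu_spec (z1 := xi0) z rf); case: Cf.
  split; first by move=> z; exact: Theta_integrable.
  exact: (Theta_H phi_gt0 psi_cyl r01 C0 phi_dist transitive shift_bip
    G_countable weights s_rho nu_spec).
have rho0 := rho_gt0 phi_gt0 psi_cyl r01 C0 phi_dist transitive weights.
have LDf : (LD r f <= C_phi phi psi r)%E.
  apply: (harmonic_LD phi_gt0 psi_cyl r01 C0 phi_dist rho0 f0 h0 _ _ Df).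
  - exact/eigenfunction_ge0.
  - exact/eigenfunction_ge0.
split => //; split => //; apply: le_lt_trans LDf _.
exact: le_lt_trans (C_phi_le psi phi_gt0 r01 C0 phi_dist) (ltry _).
Qed.
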